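(* Let $T\ge1$ and let $x_T$ be the final iterate of the Stochastic Continuous Greedy (SCG) method (defined in the context) for the problem $\max_{x\in C}F(x)$. Suppose that: (1) $\|x\|\le D$ for all $x\in C$; (2) $F:\mathcal{X}\to\mathbb{R}_+$ is monotone, $\gamma$-weakly DR-submodular, and $\|\nabla F(x)-\nabla F(y)\|\le L\|x-y\|$ for all $x,y\in\mathcal{X}$; (3) the stochastic gradients are unbiased, $\mathbb{E}_{z\sim P}[\nabla\tilde F(x,z)]=\nabla F(x)$, and $\mathbb{E}_{z\sim P}\big[\|\nabla\tilde F(x,z)-\nabla F(x)\|^2\big]\le\sigma^2$ for all $x\in\mathcal{X}$. If $\rho_t=\frac{4}{(t+8)^{2/3}}$, then $$\mathbb{E}[F(x_T)]\ge(1-e^{-\gamma})\,\mathrm{OPT}-\frac{15DQ^{1/2}}{T^{1/3}}-\frac{LD^2}{2T},$$ where $\mathrm{OPT}=\max_{x\in C}F(x)$ and $Q:=\max\{4\|\nabla F(x_0)-d_0\|^2,\ 16\sigma^2+2L^2D^2\}$.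
   Context: Setting: $\mathcal{X}=\prod_{i=1}^n\mathcal{X}_i\subset\mathbb{R}_+^n$, where each $\mathcal{X}_i=[0,a_i]$ with $a_i>0$; $C\subseteq\mathcal{X}$ is a nonempty compact convex set (not necessarily down-closed and not necessarily containing $0$). $z$ is a random variable with distribution $P$, $\tilde F(x,z)$ is a stochastic function, and $F(x)=\mathbb{E}_{z\sim P}[\tilde F(x,z)]$, with $F$ differentiable. $\|\cdot\|$ is the Euclidean norm, and vector inequalities are componentwise. $F$ is monotone if $x\le y\Rightarrow F(x)\le F(y)$ for $x,y\in\mathcal{X}$. $F$ is $\gamma$-weakly DR-submodular if $$\gamma=\inf_{x,y\in\mathcal{X},\,x\le y}\ \inf_{i\in\{1,\dots,n\}}\frac{[\nabla F(x)]_i}{[\nabla F(y)]_i},$$ where $[a]_i$ is the $i$-th coordinate of $a$; terms with $[\nabla F(y)]_i=0$ are omitted from the infimum (and $\gamma=1$ if $\nabla F\equiv0$), so that $\nabla F(x)\ge\gamma\nabla F(y)$ whenever $x\le y$. SCG method with $T$ iterations: $x_0=d_0=0$; with i.i.d. samples $z_1,z_2,\dots\sim P$, $$d_t=(1-\rho_t)d_{t-1}+\rho_t\nabla\tilde F(x_t,z_t)\quad(t\ge1),$$ $$v_t\in\arg\max_{v\in C}d_t^Tv,\qquad x_{t+1}=x_t+\frac1Tv_t\quad(t=0,1,\dots,T-1).$$ (Since $d_0=0$, $v_0$ is an arbitrary fixed point of $C$; maximizers are chosen measurably.) The expectation is over all the samples. *)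

(* Defs.v *)
From HB Require Import structures.
From mathcomp Require Import all_boot all_order all_algebra.
From mathcomp Require Import all_classical all_reals all_analysis.

Set Implicit Arguments.
Unset Strict Implicit.
Unset Printing Implicit Defensive.

Import Order.TTheory GRing.Theory Num.Theory.
Import numFieldNormedType.Exports.

Local Open Scope classical_set_scope.
Local Open Scope ring_scope.

Definition dotv (R : realType) (n : nat) (u v : 'rV[R]_n) : R :=
  \sum_(i < n) u 0 i * v 0 i.

(* The library norm on 'rV[R]_n is the sup norm; this is the Euclidean one. *)
Definition enorm (R : realType) (n : nat) (u : 'rV[R]_n) : R :=
  Num.sqrt (dotv u u).

Definition lev (R : realType) (n : nat) (u v : 'rV[R]_n) : Prop :=
  forall i, u 0 i <= v 0 i.

Definition box (R : realType) (n : nat) (a : 'rV[R]_n) : set 'rV[R]_n :=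
  [set x | lev 0 x /\ lev x a].

(* Frechet differentiability relative to X, with gradient g x at each x in X.
   Only the values of f on X matter, so that f may be a function on X alone;
   at boundary points the increments are restricted to X.  The gradient is
   unique when X is a box with positive side lengths. *)
Definition gradient_on (R : realType) (n : nat) (X : set 'rV[R]_n)
    (f : 'rV[R]_n -> R) (g : 'rV[R]_n -> 'rV[R]_n) : Prop :=
  forall x, X x -> forall e : R, 0 < e ->
    \forall y \near within X (nbhs x),
      `|f y - f x - dotv (g x) (y - x)| <= e * enorm (y - x).

Definition monotone_on (R : realType) (n : nat) (X : set 'rV[R]_n)
    (f : 'rV[R]_n -> R) : Prop :=
  forall x y, X x -> X y -> lev x y -> f x <= f y.

(* g is the gradient field on X of the function under consideration.  The
   infimum is taken in the extended reals, so that it cannot take a default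
   value. *)
Definition weakly_DR_submodular (R : realType) (n : nat) (X : set 'rV[R]_n)
    (g : 'rV[R]_n -> 'rV[R]_n) (gamma : R) : Prop :=
  ((forall x, X x -> g x = 0) -> gamma = 1) /\
  (~ (forall x, X x -> g x = 0) ->
    gamma%:E = ereal_inf [set r | exists x y i,
      [/\ X x, X y, lev x y, g y 0 i != 0 & r = (g x 0 i / g y 0 i)%:E]]).

Definition is_maximum (R : realType) (A : set R) (m : R) : Prop :=
  A m /\ ubound A m.

Definition argmax (R : realType) (U : Type) (A : set U) (f : U -> R) : set U :=
  [set u | A u /\ forall w, A w -> f w <= f u].

Definition mutually_independent (R : realType) (d d' : measure_display)
    (Omega : measurableType d) (Z : measurableType d')
    (Pr : probability Omega R) (I : set nat) (z : nat -> Omega -> Z) : Prop :=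
  forall (s : seq nat) (A : nat -> set Z), uniq s -> [set` s] `<=` I ->
    (forall t, measurable (A t)) ->
    Pr (\bigcap_(t in [set` s]) z t @^-1` A t) =
    (\prod_(t <- s) Pr (z t @^-1` A t))%E.

(* The samples are z_1, z_2, ...; z 0 is not used. *)
Definition iid_samples (R : realType) (d d' : measure_display)
    (Omega : measurableType d) (Z : measurableType d')
    (Pr : probability Omega R) (P : probability Z R)
    (z : nat -> {RV Pr >-> Z}) : Prop :=
  mutually_independent Pr [set t | (0 < t)%N] (fun t => z t : Omega -> Z) /\
  (forall t, (0 < t)%N -> forall A, measurable A ->
    distribution Pr (z t) A = P A).

(* The sigma-algebra generated by z_1, ..., z_t (trivial for t = 0). *)
Definition history (d d' : measure_display)
    (Omega : measurableType d) (Z : measurableType d')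
    (z : nat -> Omega -> Z) (t : nat) : set (set Omega) :=
  <<s \bigcup_(s in [set s | (0 < s <= t)%N])
        preimage_set_system setT (z s) measurable >>.

(* A run of T iterations of Stochastic Continuous Greedy with stochastic
   gradient oracle g and averaging weights rho.  Measurable choice of the
   maximizers: v_t is a measurable function of the samples drawn so far, so
   that it does not anticipate later samples; in particular v_0 is a fixed
   point of C. *)
Definition scg_run (R : realType) (d d' : measure_display)
    (Omega : measurableType d) (Z : measurableType d') (n : nat)
    (C : set 'rV[R]_n) (g : 'rV[R]_n -> Z -> 'rV[R]_n) (rho : nat -> R)
    (T : nat) (z : nat -> Omega -> Z) (x dd v : nat -> Omega -> 'rV[R]_n) :
    Prop :=
  [/\ forall w, x 0%N w = 0 /\ dd 0%N w = 0,
      forall t w, (0 < t < T)%N ->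
        dd t w = (1 - rho t) *: dd t.-1 w + rho t *: g (x t w) (z t w),
      forall t w, (t < T)%N -> argmax C (dotv (dd t w)) (v t w),
      forall t w, (t < T)%N -> x t.+1 w = x t w + T%:R^-1 *: v t w &
      forall t i (B : set R), (t < T)%N -> measurable B ->
        history z t ((fun w => v t w 0 i) @^-1` B)].

(* Main.v *)
Require Import Defs.
From HB Require Import structures.
From mathcomp Require Import all_boot all_order all_algebra.
From mathcomp Require Import all_classical all_reals all_analysis.
From mathcomp Require Import measurable_realfun.
From mathcomp Require Import ring lra.

Set Implicit Arguments.
Unset Strict Implicit.
Unset Printing Implicit Defensive.

Import Order.TTheory GRing.Theory Num.Theory.
Import numFieldNormedType.Exports.

Local Open Scope classical_set_scope.
Local Open Scope ring_scope.

(** The method moves by v_t / T, where v_t maximises over C the inner product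
with an estimate d_t of the gradient g_t at x_t.  Write e_t = g_t - d_t.

Deterministic part.  Monotonicity makes the gradient nonnegative, and the weak
DR property gives gamma (OPT - F(x_t)) <= <g_t, y> for a maximiser y of F on C
([weakly_DR_gap]).  Since <d_t, y> <= <d_t, v_t>, replacing d_t by g_t costs at
most 2 D |e_t|, and L-smoothness turns this into a one-step gain, so that the
gap OPT - F(x_t) contracts by 1 - gamma / T up to 2 D |e_t| / T and
L D^2 / (2 T^2) ([scg_progress]).  Unrolling uses (1 - gamma / T)^T <=
exp (- gamma) ([scg_pathwise_bound]).

Stochastic part.  Let E_t be the mean of |e_t|^2.  Given the past, d_t is an
average, with weight rho_t, of d_(t-1) and of an unbiased estimate of g_t
drawn independently, so the fresh noise contributes rho_t^2 sigma^2, and the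
bias inherited from d_(t-1) is contracted, up to the drift
|g_t - g_(t-1)| <= L D / T ([scg_error_step]).  With rho_t = 4 / (t + 8)^(2/3)
this recursion gives E_t <= Q / (t + 8)^(2/3) as long as t + 8 <= 2 T
([error_rate]).  By 2 |e_t| <= |e_t|^2 / c_t + c_t with c_t = Q^(1/2) /
(t + 8)^(1/3), the errors cost at most 2 D c_t / T each in expectation
([scg_expected_value]), and 4 D Q^(1/2) / T^(1/3) altogether.  When T <= 7 or
Q = 0, smoothness alone gives OPT <= F(0) + (3/2) D Q^(1/2), and the bound
follows from F(0) <= F(x_T).

Measure theory.  Conditioning on the past is done by Tonelli's theorem: the
pair formed by the past and the next sample has a product law, by a pi-lambda
argument on cylinders ([iid_history], [independent_integral]).  This needs the
oracle to be jointly measurable in the point and the sample, although it is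
only assumed to be the gradient of a function that is differentiable in the
point and measurable in the sample.  Such a function is jointly measurable, as
a limit of functions that are piecewise constant in the point
([caratheodory_comp_measurable]), and its gradient is a limit of difference
quotients ([gradient_measurable]). *)

(** * Euclidean inner product and norm *)

Section Euclidean.
Variables (R : realType) (n : nat).
Implicit Types u v w : 'rV[R]_n.

Lemma dotvC u v : dotv u v = dotv v u.
Proof. by apply: eq_bigr => i _; rewrite mulrC. Qed.

Lemma dotvDl u v w : dotv (u + v) w = dotv u w + dotv v w.
Proof. by rewrite -big_split; apply: eq_bigr => i _; rewrite mxE mulrDl. Qed.

Lemma dotvZl c u v : dotv (c *: u) v = c * dotv u v.
Proof. by rewrite mulr_sumr; apply: eq_bigr => i _; rewrite mxE mulrA. Qed.

Lemma dotvNl u v : dotv (- u) v = - dotv u v.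
Proof. by rewrite -scaleN1r dotvZl mulN1r. Qed.

Lemma dotvBl u v w : dotv (u - v) w = dotv u w - dotv v w.
Proof. by rewrite dotvDl dotvNl. Qed.

Lemma dotvDr u v w : dotv u (v + w) = dotv u v + dotv u w.
Proof. by rewrite dotvC dotvDl !(dotvC u). Qed.

Lemma dotvBr u v w : dotv u (v - w) = dotv u v - dotv u w.
Proof. by rewrite dotvC dotvBl !(dotvC u). Qed.

Lemma dotvZr c u v : dotv u (c *: v) = c * dotv u v.
Proof. by rewrite dotvC dotvZl dotvC. Qed.

Lemma dotv_ge0 u : 0 <= dotv u u.
Proof. by apply: sumr_ge0 => i _; rewrite -expr2 sqr_ge0. Qed.

Lemma enorm_ge0 u : 0 <= enorm u.
Proof. exact: sqrtr_ge0. Qed.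

Lemma enorm_sqr u : enorm u ^+ 2 = dotv u u.
Proof. by rewrite sqr_sqrtr// dotv_ge0. Qed.

Lemma enormZ c u : enorm (c *: u) = `|c| * enorm u.
Proof.
by rewrite /enorm dotvZl dotvZr mulrA -expr2 sqrtrM ?sqr_ge0// sqrtr_sqr.
Qed.

Lemma enorm0 : enorm (0 : 'rV[R]_n) = 0.
Proof. by rewrite -(scale0r 0) enormZ normr0 mul0r. Qed.

Lemma enorm_eq0 u : enorm u = 0 -> u = 0.
Proof.
move=> u0; have := enorm_sqr u; rewrite u0 expr0n/= => /esym/eqP.
rewrite psumr_eq0 => [/allP uP|i _]; last by rewrite -expr2 sqr_ge0.
apply/rowP => i; rewrite mxE.
by have /implyP/(_ isT) := uP i (mem_index_enum i); rewrite mulf_eq0 orbb => /eqP.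
Qed.

Lemma Cauchy_Schwarz u v : dotv u v <= enorm u * enorm v.
Proof.
have [u0|u0] := eqVneq (enorm u) 0.
  by rewrite u0 mul0r (enorm_eq0 u0) -(scale0r 0) dotvZl mul0r.
have [v0|v0] := eqVneq (enorm v) 0.
  by rewrite v0 mulr0 (enorm_eq0 v0) -(scale0r 0) dotvZr mul0r.
have uv0 : 0 < enorm u * enorm v by rewrite mulr_gt0// lt0r ?u0 ?v0 enorm_ge0.
have := dotv_ge0 (enorm v *: u - enorm u *: v).
rewrite dotvBl !dotvBr !dotvZl !dotvZr -!enorm_sqr (dotvC v u) => h.
by rewrite -subr_ge0 -(pmulr_rge0 _ uv0); nra.
Qed.

Lemma dotv_geN u v : - (enorm u * enorm v) <= dotv u v.
Proof.
rewrite lerNl -dotvNl (le_trans (Cauchy_Schwarz _ _))//.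
by rewrite -scaleN1r enormZ normrN1 mul1r.
Qed.

Lemma dotv_abs u v : `|dotv u v| <= enorm u * enorm v.
Proof. by rewrite ler_norml dotv_geN Cauchy_Schwarz. Qed.

Lemma enorm_continuous : continuous (@enorm R n).
Proof.
move=> u; apply: continuous_comp; last exact: sqrt_continuous.
apply: (@cvg_big _ _ _ _ _ add_continuous _ (nbhs u)) => i _.
by apply: cvgM; exact: coord_continuous.
Qed.

Lemma dotv_delta u i : dotv u (delta_mx 0 i) = u 0 i.
Proof.
rewrite /dotv (bigD1 i)//= big1 ?addr0; first by rewrite mxE !eqxx mulr1.
by move=> j ji; rewrite mxE (negbTE ji) andbF mulr0.
Qed.

Lemma enorm_delta i : enorm (delta_mx 0 i : 'rV[R]_n) = 1.
Proof. by rewrite /enorm dotv_delta mxE !eqxx sqrtr1. Qed.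

End Euclidean.

(** * Gradients relative to a set *)

Section Gradient.
Variables (R : realType) (n : nat).
Implicit Types (X : set 'rV[R]_n) (f : 'rV[R]_n -> R).
Implicit Types (g : 'rV[R]_n -> 'rV[R]_n) (x y : 'rV[R]_n).

Lemma gradient_on_cvg X f g x : gradient_on X f g -> X x ->
  f y @[y --> within X (nbhs x)] --> f x.
Proof.
move=> fg Xx; apply/cvgrPdist_le => e e0.
set M := enorm (g x) + 1.
have M0 : 0 < M by rewrite ltr_wpDl ?enorm_ge0.
have xcvg : enorm (y - x) @[y --> x] --> (0 : R).
  rewrite -(enorm0 R n) -(subrr x);
  apply: (@cvg_comp _ _ _ (fun y => y - x) _ _ (nbhs (x - x))).
    by apply: (@cvgB _ _ _ (nbhs x) _ id (cst x)); [exact: cvg_id|exact: cvg_cst].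
  exact: enorm_continuous.
near=> y.
have xy : `|f y - f x - dotv (g x) (y - x)| <= 1 * enorm (y - x).
  by near: y; exact: fg.
have exy : enorm (y - x) <= e / M.
  near: y; rewrite near_withinE.
  have /cvgrPdist_le/(_ (e / M) (divr_gt0 e0 M0)) := xcvg.
  by apply: filterS => y + _; rewrite sub0r normrN ger0_norm ?enorm_ge0.
have -> : f x - f y =
  - (f y - f x - dotv (g x) (y - x)) - dotv (g x) (y - x) by ring.
rewrite (le_trans (ler_normB _ _))// normrN.
rewrite (le_trans (lerD xy (dotv_abs _ _)))// -mulrDl addrC -/M.
by rewrite mulrC -ler_pdivlMr.
Unshelve. all: by end_near. Qed.

(** Interior points of the segment have two-sided neighbourhoods on which the
segment stays in X, so differentiability relative to X is an ordinary
derivative there; at the end points only continuity survives. *)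
Lemma gradient_on_path X f g x y : gradient_on X f g ->
  (forall s : R, 0 <= s <= 1 -> X (x + s *: (y - x))) ->
  (forall s : R, s \in `]0, 1[ -> is_derive s 1 (fun s : R => f (x + s *: (y - x)))
     (dotv (g (x + s *: (y - x))) (y - x))) /\
  {within `[0, 1], continuous (fun s : R => f (x + s *: (y - x)))}.
Proof.
move=> fg Xs; pose p (s : R) := x + s *: (y - x).
have pc : continuous p.
  move=> s; apply: (@cvgD _ _ _ (nbhs s) _ (cst x) ( *:%R^~ (y - x))).
    exact: cvg_cst.
  exact: (@cvgZr_tmp _ _ _ (nbhs s) _ id s (y - x) cvg_id).
have pD s s' : p s' - p s = (s' - s) *: (y - x).
  by rewrite /p opprD addrACA subrr add0r -scaleNr -scalerDl.
split; last first.
  apply/subspace_continuousP => s /=; rewrite in_itv/= => s01.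
  have := gradient_on_cvg fg (Xs _ s01); apply: cvg_trans => A /=.
  move=> nA; have : nbhs (p s) (fun y => X y -> A (f y)) by exact: nA.
  move=> /(pc s) nA'.
  have {}nA' : nbhs s (fun s' => X (p s') -> A (f (p s'))) by exact: nA'.
  suff : nbhs s (fun s' => s' \in `[0, 1] -> A (f (p s'))) by [].
  apply: filterS nA' => s' As'; rewrite in_itv/= => s'01.
  by apply: As'; exact: Xs.
move=> s; rewrite in_itv/= => s01.
have nX : \forall s' \near s, X (p s').
  case/andP : s01 => s0 s1; near=> s'; apply: Xs; apply/andP; split; apply/ltW.
    by near: s'; exact: lt_nbhsr.
  by near: s'; exact: lt_nbhsl.
set M := enorm (y - x) + 1.
have M0 : 0 < M by rewrite ltr_wpDl ?enorm_ge0.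
have Dcvg : h^-1 *: (f (p (h *: 1 + s)) - f (p s)) @[h --> 0^']
    --> dotv (g (p s)) (y - x).
  apply/cvgrPdist_le => e e0.
  have nf : \forall s' \near s,
    `|f (p s') - f (p s) - dotv (g (p s)) (p s' - p s)| <=
      e / M * enorm (p s' - p s).
    have nfX := pc s _ (fg _ (nbhs_singleton nX) _ (divr_gt0 e0 M0)).
    have {}nfX : nbhs s (fun s' => X (p s') ->
      `|f (p s') - f (p s) - dotv (g (p s)) (p s' - p s)| <=
      e / M * enorm (p s' - p s)) by exact: nfX.
    by apply: filterS2 nX nfX => s' Xs' /(_ Xs').
  have nf0 : \forall h \near 0, `|f (p (h + s)) - f (p s) -
      dotv (g (p s)) (p (h + s) - p s)| <= e / M * enorm (p (h + s) - p s).
    by rewrite (near_shift s)/= sub0r; near do rewrite /= subrK.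
  near=> h.
  have h0 : h != 0 by near: h; exact: nbhs_dnbhs_neq.
  have : `|f (p (h + s)) - f (p s) -
      dotv (g (p s)) (p (h + s) - p s)| <= e / M * enorm (p (h + s) - p s).
    by near: h; rewrite near_withinE; apply: filterS nf0 => h.
  rewrite pD addrK dotvZr enormZ mulrCA => hh.
  rewrite /GRing.scale/= mulr1.
  have -> : dotv (g (p s)) (y - x) - h^-1 * (f (p (h + s)) - f (p s)) =
     - (h^-1 * (f (p (h + s)) - f (p s) - h * dotv (g (p s)) (y - x))).
    by field.
  rewrite normrN normrM normfV ler_pdivrMl ?normr_gt0//.
  apply: le_trans hh _; rewrite ler_wpM2l//.
  by rewrite -mulrA ler_piMr ?(ltW e0)// ler_pdivrMl// mulr1 /M lerDl.
apply: DeriveDef.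
  by apply/cvg_ex; exists (dotv (g (p s)) (y - x)); exact: Dcvg.
exact: (cvg_lim _ Dcvg).
Unshelve. all: by end_near. Qed.

Lemma gradient_on_MVT X f g x y : gradient_on X f g ->
  (forall s : R, 0 <= s <= 1 -> X (x + s *: (y - x))) ->
  exists2 s : R, 0 < s < 1 &
    f y - f x = dotv (g (x + s *: (y - x))) (y - x).
Proof.
move=> fg Xs; have [df cf] := gradient_on_path fg Xs.
have [s] := @MVT _ _ (fun s => dotv (g (x + s *: (y - x))) (y - x))
  _ _ ltr01 df cf.
rewrite in_itv/= => s01 e; exists s => //.
by move: e; rewrite scale0r scale1r addr0 subrKC subr0 mulr1.
Qed.

End Gradient.

(** * Gradients on a box and weak DR-submodularity *)

Section Box.
Variables (R : realType) (n : nat) (a : 'rV[R]_n).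
Implicit Types (f : 'rV[R]_n -> R) (g : 'rV[R]_n -> 'rV[R]_n).
Implicit Types (x y : 'rV[R]_n).

Lemma box_segment x y (s : R) : box a x -> box a y -> 0 <= s <= 1 ->
  box a (x + s *: (y - x)).
Proof.
move=> [x0 xa] [y0 ya] /andP[s0 s1]; split=> i.
- by have := x0 i; have := y0 i; rewrite !mxE; nra.
- by have := xa i; have := ya i; rewrite !mxE; nra.
Qed.

(** The mean value theorem is applied to f plus the quadratic
L / 2 |. - x|^2 along the segment: its derivative is at least <g x, y - x>
by Cauchy-Schwarz, which keeps the sharp constant L / 2. *)
Lemma gradient_on_descent f g (L : R) x y : gradient_on (box a) f g ->
  (forall y y', box a y -> box a y' ->
    enorm (g y - g y') <= L * enorm (y - y')) ->
  box a x -> box a y ->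
  f x + dotv (g x) (y - x) - L / 2 * enorm (y - x) ^+ 2 <= f y.
Proof.
move=> fg gL bx by_.
have Xs (s : R) : 0 <= s <= 1 -> box a (x + s *: (y - x)) by exact: box_segment.
have [df cf] := gradient_on_path fg Xs.
set M := enorm (y - x) ^+ 2; pose k := L / 2 * M.
pose p (s : R) := x + s *: (y - x).
pose h : R -> R := (fun s => f (p s)) + k \*: (id ^+ 2 : R -> R).
have dh (s : R) : s \in `]0, 1[ ->
    is_derive s 1 h (dotv (g (p s)) (y - x) + k * (2 * s)).
  move=> s01; have dfs := df s s01.
  apply: is_derive_eq.
  by rewrite /GRing.scale/= expr1 mulr1.
have ch : {within `[0, 1], continuous h}.
  apply/subspace_continuousP => s s01; apply: cvgD.
    by move/subspace_continuousP : cf; exact.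
  apply: cvg_within_filter; apply: cvgMl_tmp.
  exact: (@cvgM _ _ (nbhs s) _ id id _ _ cvg_id cvg_id).
have [s] := MVT ltr01 dh ch; rewrite in_itv/= => /andP[s0 s1].
have -> : h 1 - h 0 = f y - f x + k.
  by rewrite /h /p !fctE/= scale0r scale1r addr0 subrKC /GRing.scale/=; ring.
rewrite subr0 mulr1 => e.
have := dotv_geN (g (p s) - g x) (y - x).
rewrite dotvBl => gg.
have s01 : 0 <= s <= 1 by rewrite !ltW.
have := gL _ _ (Xs s s01) bx;
rewrite addrAC subrr add0r enormZ (ger0_norm (ltW s0)).
have := enorm_ge0 (y - x).
rewrite -/(p s) => M0 gl.
have : enorm (g (p s) - g x) * enorm (y - x) <=
    L * (s * enorm (y - x)) * enorm (y - x).
  exact: ler_wpM2r.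
move: e gg; rewrite /k /M; lra.
Qed.

Hypothesis a_gt0 : forall i, 0 < a 0 i.

(** Partial derivatives at a boundary point of the box can only be computed from
inside: the step in direction i has length at most half a side and points away
from the nearer face. *)
Definition inward_step (i : 'I_n) (k : nat) (x : 'rV[R]_n) : R :=
  (if x 0 i <= a 0 i / 2 then 1 else - 1) * (a 0 i / 2 / k.+1%:R).

Definition inward_probe (i : 'I_n) (k : nat) (x : 'rV[R]_n) : 'rV[R]_n :=
  x + inward_step i k x *: delta_mx 0 i.

Lemma inward_step_neq0 i k x : inward_step i k x != 0.
Proof.
rewrite mulf_neq0//; last by rewrite !mulf_neq0 ?invr_eq0 ?gt_eqF.
by case: ifP => _; rewrite ?oppr_eq0 oner_neq0.
Qed.

Lemma inward_stepE i k x : `|inward_step i k x| = a 0 i / 2 / k.+1%:R.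
Proof.
rewrite normrM [X in X * _](_ : _ = 1) ?mul1r; last first.
  by case: ifP; rewrite ?normrN1 ?normr1.
by rewrite ger0_norm// !mulr_ge0// ltW.
Qed.

Lemma inward_step_le i k x : `|inward_step i k x| <= a 0 i / 2.
Proof.
rewrite inward_stepE ler_pdivrMr// ler_peMr ?divr_ge0 ?(ltW (a_gt0 i))//.
by rewrite ler1n.
Qed.

Lemma inward_probe_box i k x : box a x -> box a (inward_probe i k x).
Proof.
move=> [x0 xa].
have := inward_step_le i k x; rewrite inward_stepE => hs.
have h0 : 0 <= a 0 i / 2 / k.+1%:R by rewrite !mulr_ge0 ?(ltW (a_gt0 i)).
move: h0 hs; rewrite /inward_probe /inward_step.
set h := a 0 i / 2 / _ => h0 hs.
split=> j; have := x0 j; have := xa j; rewrite !mxE/=;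
  have [->|_] := eqVneq j i; rewrite ?mulr0 ?addr0// mulr1;
  by case: (lerP (x 0 i) (a 0 i / 2)) => ? ? ?; lra.
Qed.

Lemma inward_step_cvg0 i x : inward_step i k x @[k --> \oo] --> 0.
Proof.
apply: norm_cvg0; under eq_fun do rewrite inward_stepE.
rewrite -(mulr0 (a 0 i / 2)); apply: cvgMl_tmp; exact: cvg_harmonic.
Qed.

Lemma inward_probe_cvg i x : inward_probe i k x @[k --> \oo] --> x.
Proof.
rewrite -[X in _ --> X]addr0 -(scale0r (delta_mx 0 i)).
apply: (@cvgD _ _ _ \oo _ (cst x) (fun k => inward_step i k x *: delta_mx 0 i)).
  exact: cvg_cst.
exact: (@cvgZr_tmp _ _ _ \oo _ (inward_step i ^~ x) _ _ (inward_step_cvg0 i x)).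
Qed.

Lemma partial_derivative_cvg f g i x : gradient_on (box a) f g -> box a x ->
  (f (inward_probe i k x) - f x) / inward_step i k x @[k --> \oo] --> g x 0 i.
Proof.
move=> fg bx; apply/cvgrPdist_le => e e0.
have nfx : nbhs x (fun y => box a y ->
    `|f y - f x - dotv (g x) (y - x)| <= e * enorm (y - x)).
  exact: fg.
have {}nfx := @inward_probe_cvg i x _ nfx.
have {nfx} : \forall k \near \oo, box a (inward_probe i k x) ->
    `|f (inward_probe i k x) - f x - dotv (g x) (inward_probe i k x - x)| <=
      e * enorm (inward_probe i k x - x).
  exact: nfx.
apply: filterS => k /(_ (inward_probe_box i k bx)).
have -> : inward_probe i k x - x = inward_step i k x *: delta_mx 0 i.
  by rewrite addrAC subrr add0r.
rewrite dotvZr dotv_delta enormZ enorm_delta mulr1.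
set s := inward_step i k x; have s0 : s != 0 by exact: inward_step_neq0.
have -> : g x 0 i - (f (inward_probe i k x) - f x) / s =
  - ((f (inward_probe i k x) - f x - s * g x 0 i) / s) by field.
by rewrite normrN normf_div ler_pdivrMr ?normr_gt0.
Qed.

Lemma monotone_gradient_ge0 f g x i : gradient_on (box a) f g ->
  monotone_on (box a) f -> box a x -> 0 <= g x 0 i.
Proof.
move=> fg fm bx.
apply: (cvgr_to_ge (partial_derivative_cvg (i := i) fg bx)).
apply: nearW => k; have bp := inward_probe_box i k bx.
rewrite /inward_probe in bp *; case: (ltrP 0 (inward_step i k x)) => s0.
  rewrite divr_ge0 ?(ltW s0)// subr_ge0 fm// => j; rewrite !mxE/= lerDl.
  by rewrite mulr_ge0 ?(ltW s0).
rewrite -mulrNN -invrN mulr_ge0 ?invr_ge0 ?oppr_ge0// subr_le0 fm// => j.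
by rewrite !mxE/= gerDl mulr_le0_ge0.
Qed.

End Box.

(** The diagonal terms x = y of the infimum give gamma <= 1.  The terms with a
vanishing denominator, which the infimum omits, are harmless because g is
nonnegative. *)
Lemma weakly_DR_bounds (R : realType) (n : nat) (X : set 'rV[R]_n)
    (g : 'rV[R]_n -> 'rV[R]_n) (gamma : R) :
  (forall x i, X x -> 0 <= g x 0 i) -> weakly_DR_submodular X g gamma ->
  [/\ 0 <= gamma, gamma <= 1 &
      forall x y i, X x -> X y -> lev x y -> gamma * g y 0 i <= g x 0 i].
Proof.
move=> g0 [g1 ginf].
have [gz|gnz] := pselect (forall x, X x -> g x = 0).
  rewrite g1//; split=> // x y i Xx Xy _.
  by rewrite gz// gz// mxE mulr0.
have := ginf gnz; set S := [set _ | _] => gammaE.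
have gammale x y i : X x -> X y -> lev x y -> g y 0 i != 0 ->
    gamma <= g x 0 i / g y 0 i.
  move=> Xx Xy xy gy; rewrite -lee_fin gammaE; apply: ereal_inf_lbound.
  by exists x, y, i.
split.
- rewrite -lee_fin gammaE; apply: le_ereal_inf_tmp => _ [x [y [i [Xx Xy _ _ ->]]]].
  by rewrite lee_fin divr_ge0// g0.
- have [x [i [Xx gx]]] : exists x i, X x /\ g x 0 i != 0.
    apply: contrapT => h; apply: gnz => x Xx; apply/rowP => i; rewrite mxE.
    by apply/eqP; apply: contrapT => /negP gx; apply: h; exists x, i.
  by rewrite -(divff gx) gammale// => j.
- move=> x y i Xx Xy xy; have [->|gy] := eqVneq (g y 0 i) 0.
    by rewrite mulr0 g0.
  by rewrite -ler_pdivlMr ?gammale// lt0r gy g0.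
Qed.

(** Going from x to the componentwise maximum m of x and y only increases
coordinates, so the mean value theorem and the DR property compare F m - F x
with the gradient at x; monotonicity replaces m by y, and m - x <= y because x
and y are nonnegative. *)
Lemma weakly_DR_gap (R : realType) (n : nat) (a : 'rV[R]_n)
    (f : 'rV[R]_n -> R) (g : 'rV[R]_n -> 'rV[R]_n) (gamma : R) x y :
  0 <= gamma -> (forall x i, box a x -> 0 <= g x 0 i) ->
  (forall x y i, box a x -> box a y -> lev x y ->
    gamma * g y 0 i <= g x 0 i) ->
  gradient_on (box a) f g -> monotone_on (box a) f -> box a x -> box a y ->
  gamma * (f y - f x) <= dotv (g x) y.
Proof.
move=> gamma0 g0 gDR fg fm bx by_.
pose m : 'rV[R]_n := \row_i Num.max (x 0 i) (y 0 i).
have bm : box a m.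
  case: bx by_ => [x0 xa] [y0 ya]; split=> i; rewrite !mxE.
    by rewrite le_max; have := x0 i; rewrite mxE => ->.
  by rewrite ge_max xa ya.
have ym : lev y m by move=> i; rewrite mxE le_max lexx orbT.
have mx i : 0 <= (m - x) 0 i <= y 0 i.
  have := bx.1 i; have := by_.1 i.
  by rewrite !mxE; case: (lerP (x 0 i) (y 0 i)); lra.
have [s /andP[s0 s1] e] := gradient_on_MVT fg
  (fun s hs => box_segment bx bm hs).
have bs : box a (x + s *: (m - x)) by apply: box_segment => //; rewrite !ltW.
apply: (@le_trans _ _ (gamma * (f m - f x))).
  by rewrite ler_wpM2l// lerB// fm.
rewrite e mulr_sumr; apply: ler_sum => i _.
have /andP[mx0 mxy] := mx i.
have xs : lev x (x + s *: (m - x)).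
  by move=> j; have /andP[] := mx j; rewrite !mxE; nra.
rewrite mulrA; apply: (@le_trans _ _ (g x 0 i * (m - x) 0 i)).
  by rewrite ler_wpM2r// gDR.
by rewrite ler_wpM2l// g0.
Qed.

(** * Joint measurability *)

Section JointMeasurability.
Variables (R : realType) (n : nat) (a : 'rV[R]_n).

(** Rounding down to the grid of mesh 1 / (k + 1) stays in the box, since 0 is its
least corner, and takes countably many values. *)
Definition grid_code (k : nat) (x : 'rV[R]_n) : {ffun 'I_n -> nat} :=
  [ffun i => Num.trunc (x 0 i * k.+1%:R)].

Definition grid_point (k : nat) (m : {ffun 'I_n -> nat}) : 'rV[R]_n :=
  \row_i ((m i)%:R / k.+1%:R).

Definition grid_round k (x : 'rV[R]_n) := grid_point k (grid_code k x).

Lemma grid_round_bounds k (x : 'rV[R]_n) i : 0 <= x 0 i ->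
  x 0 i - k.+1%:R^-1 < grid_round k x 0 i <= x 0 i.
Proof.
move=> x0; rewrite mxE ffunE.
have /andP[h1 h2] := truncn_itv (mulr_ge0 x0 (ler0n R k.+1)).
rewrite ler_pdivrMr// h1 andbT ltr_pdivlMr//.
by rewrite mulrBl mulVf// ltrBlDr natr1.
Qed.

Lemma grid_round_box k x : box a x -> box a (grid_round k x).
Proof.
move=> [x0 xa]; split=> i.
  by rewrite !mxE divr_ge0.
have := x0 i; rewrite mxE => /(@grid_round_bounds k x i)/andP[_ h].
exact: le_trans h (xa i).
Qed.

Lemma grid_round_cvg x : box a x -> grid_round k x @[k --> \oo] --> x.
Proof.
move=> [x0 _]; apply/cvgrPdist_le => e e0.
near=> k; rewrite /Num.Def.normr/= mx_normrE; apply: bigmax_le; first exact: ltW.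
move=> [j i] _; rewrite /= !mxE ord1.
have := x0 i; rewrite mxE => /(@grid_round_bounds k x i).
rewrite mxE ffunE => /andP[h1 h2].
rewrite ger0_norm ?subr_ge0//.
have ke : k.+1%:R^-1 < e.
  by near: k; exact: (near_infty_natSinv_lt (PosNum e0)).
by rewrite (le_trans _ (ltW ke))// lerBlDr -lerBlDl ltW.
Unshelve. all: by end_near. Qed.

(** A function that is continuous in the point and measurable in the parameter is
measurable along any measurable choice of the point: after rounding the point to
a grid, the composite is pieced together from countably many measurable
functions, and continuity lets the mesh tend to 0. *)
Lemma caratheodory_comp_measurable (d : measure_display) (T : measurableType d)
    (f : 'rV[R]_n -> T -> R) (X : T -> 'rV[R]_n) :
  (forall y, box a y -> measurable_fun setT (f y)) ->
  (forall w y, box a y -> f u w @[u --> within (box a) (nbhs y)] --> f y w) ->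
  (forall w, box a (X w)) ->
  (forall i, measurable_fun setT (fun w => X w 0 i)) ->
  measurable_fun setT (fun w => f (X w) w).
Proof.
move=> mf cf bX mX.
apply: (@measurable_fun_cvg _ _ _ _ (fun k w => f (grid_round k (X w)) w)).
- move=> k _ B mB; rewrite setTI.
  have -> : (fun w => f (grid_round k (X w)) w) @^-1` B =
    \bigcup_(m in setT)
      ([set w | grid_code k (X w) = m] `&` (f (grid_point k m) @^-1` B)).
    apply/seteqP; split=> w /=.
      by move=> Bw; exists (grid_code k (X w)).
    by move=> [m _ [<-]].
  apply: countable_bigcupT_measurable => [|m]; first exact: countableP.
  have [bm|nbm] := pselect (box a (grid_point k m)); last first.
    rewrite [X in measurable X](_ : _ = set0)//; apply/seteqP; split=> // w /=.
    by move=> [e _]; apply: nbm; rewrite -e; exact: grid_round_box.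
  apply: measurableI; last by rewrite -[X in measurable X]setTI; exact: mf.
  rewrite [X in measurable X](_ : _ = \bigcap_(i in setT)
      ((fun w => X w 0 i) @^-1`
         [set` `[(m i)%:R / k.+1%:R, (m i).+1%:R / k.+1%:R[ ])); last first.
    have X0 w i : 0 <= X w 0 i by have := (bX w).1 i; rewrite mxE.
    have codeE w i : ((m i)%:R / k.+1%:R <= X w 0 i < (m i).+1%:R / k.+1%:R) =
        (grid_code k (X w) i == m i).
      by rewrite ffunE truncn_eq ?mulr_ge0// ler_pdivrMr// ltr_pdivlMr.
    apply/seteqP; split=> w /=.
      by move=> e i _ /=; rewrite in_itv/= codeE e.
    move=> h; apply/ffunP => i; apply/eqP; rewrite -codeE.
    by have := h i I; rewrite /= in_itv.
  apply: fin_bigcap_measurable => // i _; rewrite -[X in measurable X]setTI.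
  exact: mX.
- move=> w _; have := cf w (X w) (bX w).
  apply: cvg_trans => A nA.
  have {}nA : nbhs (X w) (fun y => box a y -> A (f y w)) by exact: nA.
  have {}nA := grid_round_cvg (bX w) nA.
  have {}nA : \forall k \near \oo, box a (grid_round k (X w)) ->
    A (f (grid_round k (X w)) w) by exact: nA.
  by apply: filterS nA => k; apply; exact: grid_round_box.
Qed.

Hypothesis a_gt0 : forall i, 0 < a 0 i.

(** The gradient itself need not be continuous in the point; it inherits
measurability as a pointwise limit of difference quotients taken inside the
box. *)
Lemma gradient_measurable (d : measure_display) (T : measurableType d)
    (f : 'rV[R]_n -> T -> R) (g : 'rV[R]_n -> T -> 'rV[R]_n)
    (X : T -> 'rV[R]_n) (i : 'I_n) :
  (forall y, box a y -> measurable_fun setT (f y)) ->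
  (forall w, gradient_on (box a) (f ^~ w) (g ^~ w)) ->
  (forall w, box a (X w)) ->
  (forall i, measurable_fun setT (fun w => X w 0 i)) ->
  measurable_fun setT (fun w => g (X w) w 0 i).
Proof.
move=> mf fg bX mX.
have mfX Y : (forall w, box a (Y w)) ->
    (forall i, measurable_fun setT (fun w => Y w 0 i)) ->
    measurable_fun setT (fun w => f (Y w) w).
  move=> bY mY; apply: caratheodory_comp_measurable => // w y by_.
  exact: gradient_on_cvg (fg w) by_.
have mstep k : measurable_fun setT (fun w => inward_step a i k (X w)).
  apply: measurable_funM; last exact: measurable_cst.
  by apply: measurable_fun_ifT => //; exact: measurable_fun_ler.
apply: (@measurable_fun_cvg _ _ _ _ (fun k w =>
  (f (inward_probe a i k (X w)) w - f (X w) w) / inward_step a i k (X w))).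
- move=> k; apply: measurable_funM.
    apply: measurable_funB; last exact: mfX.
    apply: mfX => [w|j]; first exact: inward_probe_box.
    under eq_fun do rewrite !mxE.
    apply: measurable_funD => //; apply: measurable_funM => //.
  under eq_fun do rewrite invfM (fun_if GRing.inv).
  apply: measurable_funM; last exact: measurable_cst.
  by apply: measurable_fun_ifT => //; exact: measurable_fun_ler.
- move=> w _; exact: (partial_derivative_cvg a_gt0 (i := i) (fg w) (bX w)).
Qed.
End JointMeasurability.

(** * Independence of the next sample from the past *)

Section Independence.
Variables (R : realType) (d d' : measure_display).
Variables (Omega : measurableType d) (Z : measurableType d').
Variables (Pr : probability Omega R) (P : probability Z R).

Definition sample_generator (z : nat -> Omega -> Z) (t : nat) :
    set (set Omega) :=
  \bigcup_(s in [set s | (0 < s <= t)%N])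
    preimage_set_system setT (z s) measurable.

Lemma history_measurable (z : nat -> {RV Pr >-> Z}) t A :
  history (fun t => z t : Omega -> Z) t A -> measurable A.
Proof.
apply: smallest_sub; first exact: sigma_algebra_measurable.
by move=> _ [s _ [B mB <-]]; exact: measurable_funPT.
Qed.

Lemma history_mono (z : nat -> Omega -> Z) s t A : (s <= t)%N ->
  history z s A -> history z t A.
Proof.
move=> st; apply: sub_sigma_algebra2 => B [r /= /andP[r0 rs]] zB.
by exists r => //=; rewrite r0 (leq_trans rs).
Qed.

Lemma history_sample (z : nat -> Omega -> Z) s t B : (0 < s <= t)%N ->
  measurable B -> history z t (z s @^-1` B).
Proof.
by move=> st mB; apply: sub_sigma_algebra; exists s => //; exists B; rewrite ?setTI.
Qed.

(** These sets form a pi-system that generates the history, and independence is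
assumed exactly on them. *)
Definition cylinder (z : nat -> Omega -> Z) (t : nat) : set (set Omega) :=
  [set A | exists2 B : nat -> set Z, (forall s, measurable (B s)) &
    A = \bigcap_(s in [set` iota 1 t]) z s @^-1` B s].

Lemma history_cylinder (z : nat -> Omega -> Z) t :
  history z t `<=` <<s cylinder z t >>.
Proof.
apply: sub_sigma_algebra2 => _ [s /= /andP[s0 st] [B mB <-]].
exists (fun r => if r == s then B else setT) => [r|].
  by case: ifP => // _; exact: measurableT.
apply/seteqP; split=> w /=.
  by move=> [_ zB] r _ /=; case: eqP => // ->.
move=> /(_ s); rewrite /= eqxx => h; split=> //; apply: h.
by rewrite mem_iota s0 add1n ltnS.
Qed.

Lemma cylinder_setI_closed (z : nat -> Omega -> Z) t :
  setI_closed (cylinder z t).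
Proof.
move=> _ _ [A mA ->] [B mB ->]; exists (fun s => A s `&` B s).
  by move=> s; exact: measurableI.
by rewrite -bigcapI.
Qed.

Lemma iid_cylinder (z : nat -> {RV Pr >-> Z}) t A B :
  iid_samples P z -> cylinder (fun t => z t : Omega -> Z) t A -> measurable B ->
  (Pr (A `&` z t.+1 @^-1` B) = Pr A * P B)%E.
Proof.
move=> [ind dist] [C mC ->] mB.
pose C' s := if s == t.+1 then B else C s.
have mC' s : measurable (C' s) by rewrite /C'; case: ifP.
have C'E s : s \in iota 1 t -> C' s = C s.
  by rewrite mem_iota /C' add1n => /andP[_ st]; rewrite ltn_eqF.
have -> : \bigcap_(s in [set` iota 1 t]) z s @^-1` C s `&` z t.+1 @^-1` B =
    \bigcap_(s in [set` t.+1 :: iota 1 t]) z s @^-1` C' s.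
  apply/seteqP; split=> w /=.
    move=> [CB zB] s /=; rewrite inE => /predU1P[->|st].
      by rewrite /C' eqxx.
    by rewrite C'E//; exact: CB.
  move=> h; split.
    by move=> s /= st; rewrite -C'E//; apply: h; rewrite /= inE st orbT.
  have := h t.+1; rewrite /= /C' eqxx; apply; exact: mem_head.
rewrite (ind (t.+1 :: iota 1 t) C')//; last 2 first.
  by rewrite /= iota_uniq andbT mem_iota add1n ltnn andbF.
  by move=> s /=; rewrite inE mem_iota => /predU1P[->|/andP[]].
rewrite (ind (iota 1 t) C)//; last 2 first.
  exact: iota_uniq.
  by move=> s /=; rewrite mem_iota => /andP[].
rewrite big_cons muleC; congr (_ * _)%E.
  by rewrite !big_seq; apply: eq_bigr => s st; rewrite C'E.
by rewrite /C' eqxx; exact: dist.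
Qed.

(** For fixed B, both sides are finite measures in A on the history, and they agree
on the generating pi-system of cylinders. *)
Lemma iid_history (z : nat -> {RV Pr >-> Z}) t A B :
  iid_samples P z -> history (fun t => z t : Omega -> Z) t A -> measurable B ->
  (Pr (A `&` z t.+1 @^-1` B) = Pr A * P B)%E.
Proof.
move=> iid hA mB; have {}hA := history_cylinder hA.
set K := cylinder _ t in hA.
pose H := g_sigma_algebraType K.
have mH (C : set H) : measurable C -> d.-measurable (C : set Omega).
  apply: smallest_sub; first exact: sigma_algebra_measurable.
  move=> _ [D mD ->]; apply: fin_bigcap_measurable => // s _.
  by rewrite -[X in measurable X]setTI; exact: measurable_funPT.
have mid : measurable_fun setT (idfun : Omega -> H).
  by move=> _ C mC; rewrite setTI; exact: mH.
pose idH : {RV Pr >-> H} := HB.pack (idfun : Omega -> H)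
  (isMeasurableFun.Build _ _ _ _ _ mid).
have mE : measurable (z t.+1 @^-1` B).
  by rewrite -[X in measurable X]setTI; exact: measurable_funPT.
pose m1 : {measure set H -> \bar R} := pushforward (mrestr Pr mE) idH.
have PB0 : 0 <= fine (P B) by exact: fine_ge0.
pose m2 : {measure set H -> \bar R} := mscale (NngNum PB0) (distribution Pr idH).
have -> : (Pr A * P B = m2 A)%E.
  by rewrite /= /mscale/= muleC fineK// fin_num_measure.
change (m1 mid A = m2 A).
apply: (@measure_unique _ R H K (fun=> setT)) => //.
- exact: cylinder_setI_closed.
- move=> _; exists (fun=> setT) => //.
  by apply/seteqP; split.
- by apply/seteqP; split=> // w _; exists 0%N.
- move=> C KC; rewrite /= /mscale/= fineK ?fin_num_measure// muleC.
  exact: (iid_cylinder iid KC mB).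
- move=> _; apply: (@le_lt_trans _ _ 1%E); last exact: ltry.
  rewrite /= /pushforward /mrestr preimage_setT setTI.
  exact: probability_le1.
Qed.

(** Conditioning on the sub-sigma-algebra generated by G is integration in the
second variable, because the pair of the outcome, seen through G, and of zeta
has a product law.  It is stated for nonnegative h, so that it
applies before any moment is known to be finite. *)
Lemma independent_integral (G : set (set Omega)) (zeta : {RV Pr >-> Z})
    (h : g_sigma_algebraType G * Z -> \bar R) :
  (forall A, <<s G >> A -> measurable A) ->
  (forall A B, <<s G >> A -> measurable B ->
    Pr (A `&` zeta @^-1` B) = Pr A * P B)%E ->
  measurable_fun setT h -> (forall u, 0 <= h u)%E ->
  (\int[Pr]_w h (w, zeta w) = \int[Pr]_w \int[P]_y h (w, y))%E.
Proof.
move=> mG indep mh h0.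
pose H := g_sigma_algebraType G.
have mid : measurable_fun setT (idfun : Omega -> H).
  by move=> _ C mC; rewrite setTI; exact: mG.
have mpair : measurable_fun setT (fun w : Omega => (w : H, zeta w)).
  exact: measurable_fun_pair.
pose idH : {RV Pr >-> H} := HB.pack (idfun : Omega -> H)
  (isMeasurableFun.Build _ _ _ _ _ mid).
pose pairH : {RV Pr >-> (H * Z)%type} := HB.pack (fun w : Omega => (w : H, zeta w))
  (isMeasurableFun.Build _ _ _ _ _ mpair).
transitivity (\int[distribution Pr pairH]_u h u)%E.
  by rewrite ge0_integral_distribution.
transitivity (\int[(distribution Pr idH \x P)%E]_u h u)%E.
  apply: eq_measure_integral => // X mX _; apply/esym.
  exact: (@product_measure_unique _ _ _ _ _ (distribution Pr idH) P
    (distribution Pr pairH) (fun A B mA mB => indep A B mA mB) X mX).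
rewrite fubini_tonelli1// ge0_integral_distribution//.
- exact: measurable_fun_fubini_tonelli_F.
- by move=> w; apply: integral_ge0.
Qed.

Lemma independent_integral_le (G : set (set Omega)) (zeta : {RV Pr >-> Z})
    (h : g_sigma_algebraType G * Z -> \bar R) (k : Omega -> \bar R) :
  (forall A, <<s G >> A -> measurable A) ->
  (forall A B, <<s G >> A -> measurable B ->
    Pr (A `&` zeta @^-1` B) = Pr A * P B)%E ->
  measurable_fun setT h -> (forall u, 0 <= h u)%E ->
  measurable_fun setT k -> (forall w, \int[P]_y h (w, y) <= k w)%E ->
  (\int[Pr]_w h (w, zeta w) <= \int[Pr]_w k w)%E.
Proof.
move=> mG indep mh h0 mk hk; rewrite independent_integral//.
apply: ge0_le_integral => // [w _|]; first exact: integral_ge0.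
have mF := @measurable_fun_fubini_tonelli_F _ _ _ _ _ P h mh h0.
move=> mO B mB; rewrite setTI; apply: mG.
by have := mF measurableT B mB; rewrite setTI.
Qed.

End Independence.

(** * Second moment of a noisy average *)

Section Noise.
Variables (R : realType) (n : nat) (d : measure_display).
Variables (T : measurableType d).
Implicit Types (u : T -> 'rV[R]_n).

Lemma measurable_dotv u u' :
  (forall i, measurable_fun setT (fun w => u w 0 i)) ->
  (forall i, measurable_fun setT (fun w => u' w 0 i)) ->
  measurable_fun setT (fun w => dotv (u w) (u' w)).
Proof. by move=> mu mu'; apply: measurable_sum => i; exact: measurable_funM. Qed.

Lemma measurable_enorm_sqr u :
  (forall i, measurable_fun setT (fun w => u w 0 i)) ->
  measurable_fun setT (fun w => enorm (u w) ^+ 2).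
Proof.
by move=> mu; under eq_fun do rewrite enorm_sqr; exact: measurable_dotv.
Qed.

Lemma integral_cst_probability (P : probability T R) (r : R) :
  (\int[P]_w r%:E = r%:E)%E.
Proof. by have := expectation_cst P r; rewrite unlock. Qed.

(** The cross term has zero mean because g y is unbiased for m. *)
Lemma noise_second_moment (P : probability T R) (g : T -> 'rV[R]_n)
    (m c : 'rV[R]_n) (rho sigma : R) :
  (forall i, P.-integrable setT (EFin \o (fun y => g y 0 i))) ->
  (forall i, 'E_P[(fun y => g y 0 i)%R] = (m 0 i)%:E)%E ->
  ('E_P[(fun y => enorm (g y - m) ^+ 2)%R] <= (sigma ^+ 2)%:E)%E ->
  (\int[P]_y (enorm (c + rho *: (m - g y)) ^+ 2)%:E <=
    (enorm c ^+ 2 + rho ^+ 2 * sigma ^+ 2)%:E)%E.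
Proof.
move=> ig gm gvar.
pose N y := m - g y.
have iN i : P.-integrable setT (EFin \o (fun y => N y 0 i)).
  have -> : EFin \o (fun y => N y 0 i) =
      ((EFin \o cst (m 0%R i)) \- (EFin \o (fun y => g y 0%R i)))%E.
    by apply/funext => y; rewrite /N/= !mxE EFinB.
  by apply: integrableB => //; exact: finite_measure_integrable_cst.
have iN0 i : (\int[P]_y (N y 0%R i)%:E = 0)%E.
  under eq_integral do rewrite !mxE EFinB.
  rewrite integralB_EFin//; last exact: finite_measure_integrable_cst.
  have := gm i; rewrite unlock => ->.
  by rewrite integral_cst_probability subee.
have mN i : measurable_fun setT (fun y => N y 0 i).
  by have /integrableP[/measurable_EFinP] := iN i.
have mN2 := measurable_enorm_sqr mN.
have N2 : (\int[P]_y (enorm (N y) ^+ 2)%:E <= (sigma ^+ 2)%:E)%E.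
  apply: le_trans gvar; rewrite unlock le_eqVlt; apply/orP; left; apply/eqP.
  apply: eq_integral => y _; congr (_ ^+ 2)%:E.
  by rewrite /N -opprB -scaleN1r enormZ normrN1 mul1r.
have iN2 : P.-integrable setT (EFin \o (fun y => enorm (N y) ^+ 2)).
  apply/integrableP; split; first exact/measurable_EFinP.
  under eq_integral do rewrite /= ger0_norm ?sqr_ge0//.
  exact: le_lt_trans N2 (ltry _).
have icN : P.-integrable setT (EFin \o (fun y => dotv c (N y))).
  have -> : EFin \o (fun y => dotv c (N y)) =
      (fun y => \sum_(i < n) (c 0%R i)%:E * (N y 0%R i)%:E)%E.
    by apply/funext => y; rewrite /= /dotv -sumEFin.
  apply: (integrable_sum measurableT) => i _.
  by apply: (integrableZl measurableT); exact: iN.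
have icN0 : (\int[P]_y (dotv c (N y))%:E = 0)%E.
  transitivity (\int[P]_y \sum_(i < n) (c 0%R i)%:E * (N y 0%R i)%:E)%E.
    by apply: eq_integral => y _; rewrite /dotv -sumEFin.
  rewrite (integral_sum measurableT); last first.
    by move=> i; apply: (integrableZl measurableT); exact: iN.
  rewrite big1// => i _; rewrite (integralZl measurableT (iN i)).
  by rewrite [X in (_ * X)%E](iN0 i) mule0.
have expand y : ((enorm (c + rho *: N y) ^+ 2)%:E =
    (enorm c ^+ 2)%:E + ((2 * rho)%:E * (dotv c (N y))%:E +
                         (rho ^+ 2)%:E * (enorm (N y) ^+ 2)%:E))%E.
  rewrite -!EFinM -!EFinD; move: (N y) => u; congr (_%:E).
  rewrite !enorm_sqr dotvDl !dotvDr !dotvZl !dotvZr (dotvC u c).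
  ring.
have ic : P.-integrable setT (EFin \o cst (enorm c ^+ 2)).
  exact: finite_measure_integrable_cst.
have i1 := integrableZl measurableT (2 * rho) icN.
have i2 := integrableZl measurableT (rho ^+ 2) iN2.
under eq_integral do rewrite expand.
rewrite (integralD measurableT ic (integrableD measurableT i1 i2)).
rewrite (integralD measurableT i1 i2).
rewrite (integralZl measurableT icN) [X in (_ * X)%E](icN0) mule0 add0e.
rewrite (integralZl measurableT iN2).
rewrite integral_cst_probability EFinD leeD2l// [leRHS]EFinM.
by apply: lee_wpmul2l => //; rewrite lee_fin sqr_ge0.
Qed.

End Noise.

(** * Scalar recursions *)

(** Young's inequality 2 p q <= (rho / 2) p^2 + (2 / rho) q^2 is weighted so
that the factors (1 - rho)^2 (1 + rho / 2) and (1 - rho)^2 (1 + 2 / rho) stay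
below 1 - rho / 2 and 2 / rho. *)
Lemma young_contraction (R : realType) (rho p q : R) : 0 < rho -> rho <= 1 ->
  0 <= p -> 0 <= q ->
  (1 - rho) ^+ 2 * (p ^+ 2 + 2 * (p * q) + q ^+ 2) <=
    (1 - rho / 2) * p ^+ 2 + 2 / rho * q ^+ 2.
Proof.
move=> rho0 rho1 p0 q0; set k := 2 / rho.
have rk : rho * k = 2 by rewrite /k mulrCA divff ?gt_eqF// mulr1.
have k0 : 0 < k by rewrite divr_gt0.
have young : 2 * (p * q) <= rho / 2 * p ^+ 2 + k * q ^+ 2.
  have : 0 <= k * (rho / 2 * p - q) ^+ 2 by rewrite mulr_ge0 ?sqr_ge0 ?ltW.
  have -> : k * (rho / 2 * p - q) ^+ 2 =
    rho * k * (rho / 4 * p ^+ 2 - p * q) + k * q ^+ 2 by field.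
  by rewrite rk; lra.
have sq0 := sqr_ge0 (1 - rho).
apply: (@le_trans _ _ ((1 - rho) ^+ 2 *
    ((1 + rho / 2) * p ^+ 2 + (1 + k) * q ^+ 2))).
  by apply: ler_wpM2l => //; lra.
rewrite mulrDr; apply: lerD; rewrite mulrA; apply: ler_wpM2r; rewrite ?sqr_ge0//.
  rewrite -subr_ge0; have -> : 1 - rho / 2 - (1 - rho) ^+ 2 * (1 + rho / 2) =
    rho * (1 - rho ^+ 2 / 2) by field.
  by rewrite mulr_ge0 ?(ltW rho0)//; nra.
have -> : (1 - rho) ^+ 2 * (1 + k) = (1 - rho) * (1 + k - rho - rho * k) by ring.
by rewrite rk; nra.
Qed.

Section CubeRoot.
Variable R : realType.
Implicit Types k p q r : R.

Lemma powR_third_cube k : 0 <= k -> (k `^ (1 / 3)) ^+ 3 = k.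
Proof.
move=> k0; rewrite -powR_mulrn ?powR_ge0// -powRrM div1r mulVf ?powRr1//.
Qed.

Lemma powR_two_thirds k : 0 <= k -> k `^ (2 / 3) = (k `^ (1 / 3)) ^+ 2.
Proof.
move=> k0; rewrite -[RHS]powR_mulrn ?powR_ge0// -powRrM.
by congr (_ `^ _); ring.
Qed.

Lemma powR_third_ge1 k : 1 <= k -> 1 <= k `^ (1 / 3).
Proof.
by move=> k1; rewrite -[leLHS](powRr0 k) ler_powR// divr_ge0.
Qed.

Lemma powR_third_le k k' : 0 <= k -> k <= k' -> k `^ (1 / 3) <= k' `^ (1 / 3).
Proof.
by move=> k0 kk'; apply: ge0_ler_powR; rewrite ?nnegrE ?divr_ge0// (le_trans k0).
Qed.

Lemma cube_succ_factor q r : r ^+ 3 = q ^+ 3 + 1 ->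
  (r - q) * (r ^+ 2 + r * q + q ^+ 2) = 1.
Proof.
move=> e; have -> : (r - q) * (r ^+ 2 + r * q + q ^+ 2) = r ^+ 3 - q ^+ 3 by ring.
by rewrite e addrAC subrr add0r.
Qed.

Lemma cube_succ_sqr q r : 1 <= q -> 1 <= r -> r ^+ 3 = q ^+ 3 + 1 ->
  r ^+ 2 - q ^+ 2 <= 1.
Proof.
move=> q1 r1 e.
have fact := cube_succ_factor e.
have qr0 : 0 < r ^+ 2 + r * q + q ^+ 2 by nra.
have rq : 0 <= r - q.
  by rewrite -(pmulr_lge0 _ qr0) fact.
have -> : r ^+ 2 - q ^+ 2 = (r - q) * (r + q) by ring.
by rewrite -[leRHS]fact ler_wpM2l//; nra.
Qed.

Lemma inv_cube_root_le q r : 0 <= q -> 0 < r -> r ^+ 3 = q ^+ 3 + 1 ->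
  r^-1 <= 2 * (r ^+ 2 - q ^+ 2).
Proof.
move=> q0 r0 e.
have fact := cube_succ_factor e.
have qr0 : 0 < r ^+ 2 + r * q + q ^+ 2 by nra.
have rq : 0 <= r - q.
  by rewrite -(pmulr_lge0 _ qr0) fact.
rewrite -[r^-1]mul1r ler_pdivrMr// -[leLHS]fact.
have -> : 2 * (r ^+ 2 - q ^+ 2) * r = (r - q) * (2 * (r + q) * r) by ring.
by rewrite ler_wpM2l//; nra.
Qed.

(** Comparison with the telescoping sum of the differences of t^(2/3). *)
Lemma sum_inv_cube_root (T : nat) :
  \sum_(t < T) ((t%:R + 8) `^ (1 / 3) : R)^-1 <= 2 * (T%:R `^ (1 / 3)) ^+ 2.
Proof.
elim: T => [|T ih]; first by rewrite big_ord0 mulr_ge0 ?sqr_ge0.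
rewrite big_ord_recr/=.
pose q : R := T%:R `^ (1 / 3); pose r : R := T.+1%:R `^ (1 / 3).
rewrite -/q in ih; rewrite -/r.
have r0 : 0 < r by rewrite powR_gt0.
have := @inv_cube_root_le q r (powR_ge0 _ _) r0.
rewrite !powR_third_cube// -natr1 => /(_ erefl) h.
have : ((T%:R + 8) `^ (1 / 3) : R)^-1 <= r^-1.
  rewrite lef_pV2 ?posrE ?powR_gt0 ?ltr_wpDl//.
  by apply: powR_third_le => //; rewrite -[T.+1%:R]natr1; lra.
lra.
Qed.

End CubeRoot.

Lemma affine_recursion (R : realType) (u c : nat -> R) (q : R) (T : nat) :
  0 <= q -> q <= 1 -> (forall t, 0 <= c t) ->
  (forall t, (t < T)%N -> u t.+1 <= q * u t + c t) ->
  u T <= q ^+ T * u 0%N + \sum_(t < T) c t.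
Proof.
move=> q0 q1 c0; elim: T => [|T ih] rec; first by rewrite big_ord0 mul1r addr0.
have uT := ih (fun t tT => rec t (ltnW tT)).
apply: le_trans (rec T (ltnSn T)) _; rewrite big_ord_recr/= addrA lerD2r.
apply: le_trans (ler_wpM2l q0 uT) _; rewrite mulrDr exprS mulrA lerD2l.
by rewrite ler_piMl// sumr_ge0.
Qed.

(** In terms of r_t = (t + 8)^(1/3) the step size is 4 / r_t^2.  As t + 8 <= 2 T,
the drift term is at most 4 L^2 D^2 / r_t^6, so drift and noise together add at
most Q / r_t^4, and the induction step reduces to r_t^2 - r_(t-1)^2 <= 1.  The
induction starts because r_0 = 2. *)
Lemma error_rate (R : realType) (E : nat -> \bar R) (rho : nat -> R)
    (Q L D sigma : R) (T : nat) :
  (7 <= T)%N -> (forall t, rho t = 4 / ((t%:R + 8) `^ (2 / 3))) ->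
  (E 0%N <= (Q / 4)%:E)%E ->
  16 * sigma ^+ 2 + 2 * L ^+ 2 * D ^+ 2 <= Q ->
  (forall t, (t.+1 < T)%N -> 0 < rho t.+1 -> rho t.+1 <= 1 ->
    (E t.+1 <= (1 - rho t.+1 / 2)%:E * E t +
      (2 / rho t.+1 * (L * D / T%:R) ^+ 2 +
       rho t.+1 ^+ 2 * sigma ^+ 2)%:E)%E) ->
  forall t, (t < T)%N -> (E t <= (Q / ((t%:R + 8) `^ (1 / 3)) ^+ 2)%:E)%E.
Proof.
move=> T7 rhoE E0 QE rec; pose r t : R := (t%:R + 8) `^ (1 / 3).
have Q0 : 0 <= Q.
  have := sqr_ge0 sigma; have := mulr_ge0 (sqr_ge0 L) (sqr_ge0 D); lra.
have r3 t : r t ^+ 3 = t%:R + 8 by rewrite powR_third_cube// addr_ge0.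
have r1 t : 1 <= r t.
  by apply: powR_third_ge1; have := ler0n R t; lra.
have r2 t : 2 <= r t.
  by rewrite -(ler_pXn2r (n := 3))// ?nnegrE ?(le_trans _ (r1 t))// r3;
    have := ler0n R t; lra.
have rho_r t : rho t = 4 / r t ^+ 2 by rewrite rhoE powR_two_thirds// addr_ge0.
elim=> [_|t ih tT].
  have r00 : r 0%N = 2.
    apply/eqP; rewrite -(@eqrXn2 _ 3) ?(le_trans _ (r1 0%N))// r3 add0r.
    by apply/eqP; ring.
  by rewrite -/(r 0%N) r00 (_ : 2 ^+ 2 = 4) //; ring.
have rt0 : 0 < r t.+1 by rewrite (lt_le_trans _ (r1 _)).
have rt20 : 0 < r t.+1 ^+ 2 by rewrite exprn_gt0.
have r4 : 4 <= r t.+1 ^+ 2 by have := r2 t.+1; nra.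
have rho0 : 0 < rho t.+1 by rewrite rho_r divr_gt0.
have rho1 : rho t.+1 <= 1 by rewrite rho_r ler_pdivrMr// mul1r.
apply: le_trans (rec t tT rho0 rho1) _.
have rho2 : (0 <= (1 - rho t.+1 / 2)%:E)%E by rewrite lee_fin; lra.
apply: le_trans (leeD2r _ (lee_wpmul2l rho2 (ih (ltnW tT)))) _.
rewrite -EFinM -EFinD lee_fin -!/(r _) rho_r.
set q := r t; set p := r t.+1.
have q1 : 1 <= q by exact: r1.
have p1 : 1 <= p by exact: r1.
have pq : p ^+ 3 = q ^+ 3 + 1 by rewrite !r3 -natr1; ring.
have p0 : p != 0 by rewrite gt_eqF.
have q0 : q != 0 by rewrite gt_eqF// (lt_le_trans _ q1).
have T0 : 0 < T%:R :> R by rewrite ltr0n (leq_trans _ T7).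
have pT : p ^+ 3 <= 2 * T%:R.
  by rewrite r3 -natrD -natrM ler_nat mul2n -addnn -(addSnnS t.+1 7) leq_add.
have drift : (L * D / T%:R) ^+ 2 <= 4 * (L ^+ 2 * D ^+ 2) / p ^+ 6.
  have -> : 4 * (L ^+ 2 * D ^+ 2) / p ^+ 6 = L ^+ 2 * D ^+ 2 * (4 / p ^+ 6).
    by rewrite mulrAC mulrC.
  rewrite !exprMn exprVn ler_wpM2l ?(mulr_ge0 (sqr_ge0 L) (sqr_ge0 D))//.
  rewrite ler_pdivlMr ?exprn_gt0// [leLHS]mulrC ler_pdivrMr ?exprn_gt0//.
  have -> : p ^+ 6 = (p ^+ 3) ^+ 2 by ring.
  have -> : 4 * T%:R ^+ 2 = (2 * T%:R) ^+ 2 :> R by ring.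
  by rewrite ler_sqr ?nnegrE ?exprn_ge0 ?mulr_ge0 ?(ltW T0) ?(ltW rt0).
(* This is where the constants 16 and 2 in Q come from. *)
have noise : 2 / (4 / p ^+ 2) * (L * D / T%:R) ^+ 2 +
    (4 / p ^+ 2) ^+ 2 * sigma ^+ 2 <= Q / p ^+ 4.
  apply: le_trans (_ : _ <= 2 / (4 / p ^+ 2) *
    (4 * (L ^+ 2 * D ^+ 2) / p ^+ 6) + (4 / p ^+ 2) ^+ 2 * sigma ^+ 2) _.
    by rewrite lerD2r ler_wpM2l// ?divr_ge0 ?exprn_ge0 ?(ltW rt0).
  have -> : 2 / (4 / p ^+ 2) * (4 * (L ^+ 2 * D ^+ 2) / p ^+ 6) +
      (4 / p ^+ 2) ^+ 2 * sigma ^+ 2 =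
      (16 * sigma ^+ 2 + 2 * L ^+ 2 * D ^+ 2) / p ^+ 4 by field.
  by rewrite ler_pM2r// invr_gt0 exprn_gt0.
have contraction : (1 - 4 / p ^+ 2 / 2) * (Q / q ^+ 2) + Q / p ^+ 4 <= Q / p ^+ 2.
  rewrite -subr_ge0.
  have -> : Q / p ^+ 2 - ((1 - 4 / p ^+ 2 / 2) * (Q / q ^+ 2) + Q / p ^+ 4) =
    Q * (p ^+ 2 * (1 - (p ^+ 2 - q ^+ 2)) + (p ^+ 2 - q ^+ 2)) / (q ^+ 2 * p ^+ 4)
    by field; rewrite p0 q0.
  have pq2 := cube_succ_sqr q1 p1 pq.
  have qp : q <= p.
    by rewrite -(ler_pXn2r (n := 3))// ?nnegrE ?(le_trans _ q1)
      ?(le_trans _ p1)// pq; lra.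
  have qp2 : q ^+ 2 <= p ^+ 2 by nra.
  rewrite divr_ge0// ?mulr_ge0 ?exprn_ge0 ?(ltW rt0) ?(le_trans _ q1)//.
  rewrite addr_ge0 ?subr_ge0// mulr_ge0 ?exprn_ge0 ?(ltW rt0)//; lra.
by move: noise contraction; lra.
Qed.

(** * Runs of the method *)

Section Run.
Variables (R : realType) (n : nat) (d d' : measure_display).
Variables (Omega : measurableType d) (Pr : probability Omega R).
Variables (Z : measurableType d') (P : probability Z R).
Variables (a : 'rV[R]_n) (C : set 'rV[R]_n).
Variables (Ft : 'rV[R]_n -> Z -> R) (gFt : 'rV[R]_n -> Z -> 'rV[R]_n).
Variables (F : 'rV[R]_n -> R) (gF : 'rV[R]_n -> 'rV[R]_n).
Variables (D L sigma : R) (T : nat) (rho : nat -> R).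
Variables (z : nat -> {RV Pr >-> Z}) (x dd v : nat -> Omega -> 'rV[R]_n).
Hypothesis a_gt0 : forall i, 0 < a 0 i.
Hypothesis C_sub : C `<=` box a.
Hypothesis C_bounded : forall y, C y -> enorm y <= D.
Hypothesis F_diff : gradient_on (box a) F gF.
Hypothesis gF_Lipschitz : forall y y', box a y -> box a y' ->
  enorm (gF y - gF y') <= L * enorm (y - y').
Hypothesis L_ge0 : 0 <= L.
Hypothesis T_gt0 : (0 < T)%N.
Hypothesis run : scg_run C gFt rho T (fun t => z t : Omega -> Z) x dd v.

Let zO := fun t => z t : Omega -> Z.
Let H t := g_sigma_algebraType (sample_generator zO t).

Definition scg_error t w := gF (x t w) - dd t w.

Lemma scg_direction_in t w : (t < T)%N -> C (v t w).
Proof. by case: run => _ _ + _ _ tT => /(_ t w tT)[]. Qed.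

Lemma scg_step t w : (t < T)%N -> x t.+1 w - x t w = T%:R^-1 *: v t w.
Proof.
by case: run => _ _ _ + _ tT => /(_ t w tT) ->; rewrite addrAC subrr add0r.
Qed.

Lemma scg_iterate_bounds t w i : (t <= T)%N ->
  0 <= x t w 0 i <= t%:R / T%:R * a 0 i.
Proof.
case: run => x0 _ _ xS _.
elim: t => [_|t ih tT]; first by rewrite (x0 w).1 mxE mul0r mul0r lexx.
have /andP[xt0 xta] := ih (ltnW tT).
have [/(_ i) v0 /(_ i) va] := C_sub (scg_direction_in w tT).
have T0 : 0 < T%:R^-1 :> R by rewrite invr_gt0 ltr0n.
rewrite xS// !mxE in v0 *; rewrite addr_ge0 ?mulr_ge0 ?(ltW T0)//=.
rewrite -natr1 mulrDl mulrDl lerD// mul1r ler_pM2l//.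
Qed.

Lemma scg_iterate_box t w : (t <= T)%N -> box a (x t w).
Proof.
move=> tT; split=> i; have /andP[xt0 xta] := scg_iterate_bounds w i tT.
  by rewrite mxE.
apply: le_trans xta _; rewrite ler_piMl ?(ltW (a_gt0 i))//.
by rewrite ler_pdivrMr ?ltr0n// mul1r ler_nat.
Qed.

Lemma history_measurable_fun_mono s t (f : Omega -> R) : (s <= t)%N ->
  measurable_fun setT (f : H s -> R) -> measurable_fun setT (f : H t -> R).
Proof.
move=> st mf mO B mB; rewrite setTI; apply: (history_mono st).
by have := mf measurableT B mB; rewrite setTI.
Qed.

Lemma history_measurable_funW t (f : Omega -> R) :
  measurable_fun setT (f : H t -> R) -> measurable_fun setT f.
Proof.
move=> mf mO B mB; rewrite setTI; apply: (@history_measurable _ _ _ _ _ _ z t).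
by have := mf measurableT B mB; rewrite setTI.
Qed.

Lemma scg_direction_measurable t i : (t < T)%N ->
  measurable_fun setT ((fun w => v t w 0 i) : H t -> R).
Proof.
case: run => _ _ _ _ mv tT mO B mB; rewrite setTI; exact: mv.
Qed.

(** The index t - 1, which is 0 for t = 0, records that x_t precedes z_t. *)
Lemma scg_iterate_measurable t i : (t <= T)%N ->
  measurable_fun setT ((fun w => x t w 0 i) : H t.-1 -> R).
Proof.
case: run => x0 _ _ xS _.
elim: t => [_|t ih tT].
  by under eq_fun do rewrite (x0 _).1 mxE; exact: measurable_cst.
under eq_fun do rewrite (xS _ _ tT) !mxE.
apply: measurable_funD.
  by apply: (history_measurable_fun_mono (leq_pred t)); exact: ih (ltnW tT).
by apply: measurable_funM => //; exact: scg_direction_measurable.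
Qed.

Hypothesis Ft_measurable : forall y, box a y -> measurable_fun setT (Ft y).
Hypothesis Ft_diff : forall zeta, gradient_on (box a) (Ft ^~ zeta) (gFt ^~ zeta).

(** The estimate evaluates the oracle at a point that itself depends on the past,
which is where joint measurability is needed. *)
Lemma scg_estimate_measurable t i : (t < T)%N ->
  measurable_fun setT ((fun w => dd t w 0 i) : H t -> R).
Proof.
case: run => x0 ddS _ _ _.
elim: t i => [i _|t ih i tT].
  by under eq_fun do rewrite (x0 _).2 mxE; exact: measurable_cst.
under eq_fun do rewrite (ddS _ _ _)// !mxE/=.
apply: measurable_funD; apply: measurable_funM => //.
  by apply: (history_measurable_fun_mono (leqnSn t)); exact: ih (ltnW tT).
have mz : measurable_fun setT (zO t.+1 : H t.+1 -> Z).
  move=> mO B mB; rewrite setTI; apply: history_sample => //.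
  by rewrite ltnSn.
apply: (@gradient_measurable R n a a_gt0 _ (H t.+1)
  (fun y w => Ft y (zO t.+1 w)) (fun y w => gFt y (zO t.+1 w)) (x t.+1) i).
- move=> y by_; exact: measurableT_comp (Ft_measurable by_) mz.
- by move=> w; exact: Ft_diff.
- by move=> w; apply: scg_iterate_box; exact: ltnW.
- move=> j; apply: (history_measurable_fun_mono (leqnSn t)).
  exact: (@scg_iterate_measurable t.+1 j (ltnW tT)).
Qed.

Lemma scg_gradient_measurable t i : (t <= T)%N ->
  measurable_fun setT ((fun w => gF (x t w) 0 i) : H t.-1 -> R).
Proof.
move=> tT; apply: (@gradient_measurable R n a a_gt0 _ (H t.-1)
  (fun y w => F y) (fun y w => gF y) (x t) i) => [y _|w|w|j].
- exact: measurable_cst.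
- exact: F_diff.
- exact: scg_iterate_box.
- exact: scg_iterate_measurable.
Qed.

Lemma scg_value_measurable t : (t <= T)%N ->
  measurable_fun setT (fun w => F (x t w)).
Proof.
move=> tT; apply: (@history_measurable_funW t.-1).
apply: (@caratheodory_comp_measurable R n a _ (H t.-1) (fun y w => F y) (x t)).
- by move=> y _; exact: measurable_cst.
- by move=> w y by_; exact: gradient_on_cvg F_diff by_.
- by move=> w; exact: scg_iterate_box.
- by move=> i; exact: scg_iterate_measurable.
Qed.

Lemma scg_error_measurable t : (t < T)%N ->
  measurable_fun setT (fun w => enorm (scg_error t w) ^+ 2).
Proof.
move=> tT; apply: (@history_measurable_funW t).
apply: measurable_enorm_sqr => i; under eq_fun do rewrite !mxE.
apply: measurable_funB; last exact: scg_estimate_measurable.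
apply: (history_measurable_fun_mono (leq_pred t)).
by apply: scg_gradient_measurable; exact: ltnW.
Qed.

Lemma scg_gradient_drift t w : (t.+1 < T)%N ->
  enorm (gF (x t.+1 w) - gF (x t w)) <= L * D / T%:R.
Proof.
move=> tT; have tT' := ltnW tT.
apply: le_trans
  (gF_Lipschitz (scg_iterate_box w tT') (scg_iterate_box w (ltnW tT'))) _.
rewrite scg_step// -mulrA ler_wpM2l// enormZ ger0_norm ?invr_ge0//.
by rewrite mulrC ler_wpM2r ?invr_ge0// C_bounded//; exact: scg_direction_in.
Qed.

Hypothesis gFt_integrable : forall y i, box a y ->
  P.-integrable setT (EFin \o (fun zeta => gFt y zeta 0 i)).
Hypothesis gFt_unbiased : forall y i, box a y ->
  ('E_P[(fun zeta => gFt y zeta 0 i)%R] = (gF y 0 i)%R%:E)%E.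
Hypothesis gFt_variance : forall y, box a y ->
  ('E_P[(fun zeta => enorm (gFt y zeta - gF y) ^+ 2)%R]
     <= (sigma ^+ 2)%R%:E)%E.
Hypothesis z_iid : iid_samples P z.

(** With the past fixed, e_(t+1) is a deterministic part (1 - rho) (A + B), where A
is the previous error and B the drift of the gradient, plus rho times a centred
noise.  Integrating the noise first leaves (1 - rho)^2 |A + B|^2 +
rho^2 sigma^2. *)
Lemma scg_error_step t : (t.+1 < T)%N -> 0 < rho t.+1 -> rho t.+1 <= 1 ->
  (\int[Pr]_w (enorm (scg_error t.+1 w) ^+ 2)%:E <=
   (1 - rho t.+1 / 2)%:E * \int[Pr]_w (enorm (scg_error t w) ^+ 2)%:E +
   (2 / rho t.+1 * (L * D / T%:R) ^+ 2 + rho t.+1 ^+ 2 * sigma ^+ 2)%:E)%E.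
Proof.
move=> tT r0 r1; set r := rho t.+1 in r0 r1 *.
have tT' := ltnW tT; have tT'' := ltnW tT'.
pose c w := (1 - r) *: (gF (x t.+1 w) - dd t w).
pose h (u : H t * Z) :=
  (enorm (c u.1 + r *: (gF (x t.+1 u.1) - gFt (x t.+1 u.1) u.2)) ^+ 2)%:E.
pose b := 2 / r * (L * D / T%:R) ^+ 2 + r ^+ 2 * sigma ^+ 2.
pose k w := ((1 - r / 2) * enorm (scg_error t w) ^+ 2 + b)%:E.
have err_h w : (enorm (scg_error t.+1 w) ^+ 2)%:E = h (w, zO t.+1 w).
  rewrite /h /c /scg_error/=; congr (enorm _ ^+ 2)%:E.
  case: run => _ /(_ t.+1 w) -> // _ _ _; rewrite -/r/=.
  by apply/rowP => i; rewrite !mxE/=; ring.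
under eq_integral do rewrite err_h.
apply: (@le_trans _ _ (\int[Pr]_w k w)%E); last first.
  have err0 w : (0 <= (enorm (scg_error t w) ^+ 2)%:E)%E.
    by rewrite lee_fin sqr_ge0.
  have merr : measurable_fun setT (fun w => (enorm (scg_error t w) ^+ 2)%:E).
    by apply/measurable_EFinP; exact: scg_error_measurable.
  have r2 : 0 <= 1 - r / 2 by lra.
  have b0 : 0 <= b.
    by rewrite addr_ge0// mulr_ge0// ?sqr_ge0// divr_ge0 ?(ltW r0).
  rewrite /k; under eq_integral do rewrite EFinD EFinM.
  rewrite ge0_integralD//; last 2 first.
  - by move=> w _; rewrite mule_ge0// lee_fin.
  - exact: measurable_funeM.
  by rewrite ge0_integralZl_EFin// integral_cst_probability.
apply: (@independent_integral_le _ _ _ _ _ Pr P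
  (sample_generator zO t) (z t.+1) h k).
- by move=> A; exact: history_measurable.
- by move=> A B hA mB; apply: iid_history => //.
- apply/measurable_EFinP; apply: measurable_enorm_sqr => i.
  have fst_m (f : Omega -> R) : measurable_fun setT (f : H t -> R) ->
      measurable_fun setT (fun u : H t * Z => f u.1).
    by move=> mf; exact: measurableT_comp mf measurable_fst.
  have mg : measurable_fun setT (fun u : H t * Z => gF (x t.+1 u.1) 0 i).
    by apply: (fst_m (fun w => gF (x t.+1 w) 0 i));
      exact: (@scg_gradient_measurable t.+1 i tT').
  have md : measurable_fun setT (fun u : H t * Z => dd t u.1 0 i).
    by apply: (fst_m (fun w => dd t w 0 i)); exact: scg_estimate_measurable.
  have mgt : measurable_fun setT (fun u : H t * Z => gFt (x t.+1 u.1) u.2 0 i).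
    apply: (@gradient_measurable R n a a_gt0 _ (H t * Z)%type
      (fun y u => Ft y u.2) (fun y u => gFt y u.2) (fun u => x t.+1 u.1) i).
    + move=> y by_; exact: measurableT_comp (Ft_measurable by_) measurable_snd.
    + by move=> u; exact: Ft_diff.
    + by move=> u; exact: scg_iterate_box.
    + move=> j; apply: (fst_m (fun w => x t.+1 w 0 j)).
      exact: (@scg_iterate_measurable t.+1 j tT').
  under eq_fun do rewrite !mxE.
  apply: measurable_funD; apply: measurable_funM => //.
    exact: measurable_funB.
  exact: measurable_funB.
- by move=> u; rewrite lee_fin sqr_ge0.
- apply/measurable_EFinP; apply: measurable_funD => //.
  by apply: measurable_funM => //; exact: scg_error_measurable.
- move=> w; have bx := scg_iterate_box w tT'.
  apply: (@le_trans _ _ (enorm (c w) ^+ 2 + r ^+ 2 * sigma ^+ 2)%:E).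
    exact: (noise_second_moment (c w) r (fun i => gFt_integrable i bx)
      (fun i => gFt_unbiased i bx) (gFt_variance bx)).
  rewrite /k lee_fin /b addrA lerD2r.
  set A := scg_error t w; set B := gF (x t.+1 w) - gF (x t w).
  have -> : c w = (1 - r) *: (A + B).
    by congr (_ *: _); rewrite /A /B /scg_error [RHS]addrC addrA subrK.
  rewrite enormZ exprMn -normrX ger0_norm ?sqr_ge0//.
  have Bb : enorm B <= L * D / T%:R by exact: scg_gradient_drift.
  clearbody A B.
  apply: le_trans (_ : _ <= (1 - r / 2) * enorm A ^+ 2 + 2 / r * enorm B ^+ 2) _.
    apply: le_trans (young_contraction r0 r1 (enorm_ge0 A) (enorm_ge0 B)).
    rewrite ler_wpM2l ?sqr_ge0// [leLHS]enorm_sqr dotvDl !dotvDr (dotvC B A).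
    by rewrite -!enorm_sqr; have := Cauchy_Schwarz A B; lra.
  rewrite lerD2l ler_wpM2l ?(ltW (divr_gt0 _ _))//.
  by rewrite ler_sqr ?nnegrE ?enorm_ge0// (le_trans _ Bb)// enorm_ge0.
Qed.

Variables (gamma : R) (y : 'rV[R]_n).
Hypothesis gamma_ge0 : 0 <= gamma.
Hypothesis gamma_le1 : gamma <= 1.
Hypothesis gF_ge0 : forall u i, box a u -> 0 <= gF u 0 i.
Hypothesis gF_DR : forall u u' i, box a u -> box a u' -> lev u u' ->
  gamma * gF u' 0 i <= gF u 0 i.
Hypothesis F_monotone : monotone_on (box a) F.
Hypothesis F_ge0 : forall u, box a u -> 0 <= F u.
Hypothesis Cy : C y.

(** The maximiser v_t is at least as good as y for the estimated gradient;
passing to the true gradient on both sides costs at most D |e_t| each. *)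
Lemma scg_progress t w : (t < T)%N ->
  F y - F (x t.+1 w) <= (1 - gamma / T%:R) * (F y - F (x t w)) +
    (2 * D / T%:R * enorm (scg_error t w) + L * D ^+ 2 / (2 * T%:R ^+ 2)).
Proof.
move=> tT; have bx := scg_iterate_box w (ltnW tT).
have Cv := scg_direction_in w tT.
have gap := weakly_DR_gap gamma_ge0 gF_ge0 gF_DR F_diff F_monotone bx (C_sub Cy).
have opt : dotv (dd t w) y <= dotv (dd t w) (v t w).
  by case: run => _ _ /(_ t w tT)[_ + ] _ _; apply.
set e := scg_error t w; set s := T%:R^-1.
have s0 : 0 <= s by rewrite invr_ge0.
have D0 : 0 <= D by exact: le_trans (enorm_ge0 y) (C_bounded Cy).
have bound u : C u -> enorm e * enorm u <= D * enorm e.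
  by move=> Cu; rewrite mulrC ler_wpM2r ?enorm_ge0// C_bounded.
have ascent : gamma * (F y - F (x t w)) - 2 * D * enorm e <=
    dotv (gF (x t w)) (v t w).
  have := dotv_geN e (v t w); have := Cauchy_Schwarz e y.
  have := bound _ Cv; have := bound _ Cy.
  by move: gap; rewrite /e /scg_error !dotvBl; lra.
have := gradient_on_descent F_diff gF_Lipschitz bx (scg_iterate_box w tT).
rewrite scg_step// dotvZr enormZ (ger0_norm s0) exprMn -/s => desc.
have Lv : L / 2 * (s ^+ 2 * enorm (v t w) ^+ 2) <= L / 2 * (s ^+ 2 * D ^+ 2).
  rewrite ler_wpM2l ?divr_ge0// ler_wpM2l ?sqr_ge0//.
  by rewrite ler_sqr ?nnegrE ?enorm_ge0 ?C_bounded.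
have -> : L * D ^+ 2 / (2 * T%:R ^+ 2) = L / 2 * (s ^+ 2 * D ^+ 2).
  by rewrite invfM exprVn; ring.
have := ler_wpM2l s0 ascent; rewrite -/s; lra.
Qed.

Lemma scg_pathwise_bound w :
  (1 - expR (- gamma)) * F y - L * D ^+ 2 / (2 * T%:R) <=
    F (x T w) + \sum_(t < T) 2 * D / T%:R * enorm (scg_error t w).
Proof.
have T0 : 0 < T%:R :> R by rewrite ltr0n.
have q0 : 0 <= 1 - gamma / T%:R.
  by rewrite subr_ge0 ler_pdivrMr// mul1r (le_trans gamma_le1)// ler1n.
have q1 : 1 - gamma / T%:R <= 1 by rewrite gerBl divr_ge0// ltW.
have D0 : 0 <= D := le_trans (enorm_ge0 y) (C_bounded Cy).
have [x00 _ _ _ _] := run.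
have step_ge0 t : 0 <= 2 * D / T%:R * enorm (scg_error t w) +
    L * D ^+ 2 / (2 * T%:R ^+ 2).
  apply: addr_ge0.
    by rewrite mulr_ge0 ?enorm_ge0// divr_ge0 ?mulr_ge0 ?(ltW T0).
  by rewrite divr_ge0// ?mulr_ge0// ?sqr_ge0.
have := affine_recursion q0 q1 step_ge0 (fun t => @scg_progress t w).
rewrite (x00 w).1 => rec.
have b0 : box a 0 by split=> i; rewrite mxE// ltW.
have by_ := C_sub Cy.
have Fy0 : F 0 <= F y by exact: (F_monotone b0 by_ by_.1).
have qT : (1 - gamma / T%:R) ^+ T * (F y - F 0) <= expR (- gamma) * F y.
  apply: ler_pM; [exact: exprn_ge0|by rewrite subr_ge0| |by rewrite gerBl F_ge0].
  have -> : expR (- gamma) = expR (- gamma / T%:R) ^+ T.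
    by rewrite -expRM_natr mulfVK ?gt_eqF.
  by rewrite lerXn2r ?nnegrE ?expR_ge0// (le_trans _ (expR_ge1Dx _))// mulNr.
have smooth : \sum_(t < T) L * D ^+ 2 / (2 * T%:R ^+ 2) =
    L * D ^+ 2 / (2 * T%:R).
  by rewrite sumr_const card_ord -[LHS]mulr_natr; field; rewrite gt_eqF.
by move: rec; rewrite big_split/= smooth; lra.
Qed.

(** Through 2 |e| <= |e|^2 / c + c, the bound along each run becomes linear in the
squared errors, which are the quantities whose means are controlled. *)
Lemma scg_expected_value (c : nat -> R) : (forall t, 0 < c t) ->
  (forall t, (t < T)%N ->
    \int[Pr]_w (enorm (scg_error t w) ^+ 2)%:E <= (c t ^+ 2)%:E)%E ->
  (((1 - expR (- gamma)) * F y - L * D ^+ 2 / (2 * T%:R) -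
     \sum_(t < T) 2 * D / T%:R * c t)%:E <= \int[Pr]_w (F (x T w))%:E)%E.
Proof.
move=> c0 rate; pose err t w := enorm (scg_error t w).
pose b t w := D / T%:R * (err t w ^+ 2 / c t + c t).
set K := _ - L * _ / _.
have T0 : 0 < T%:R :> R by rewrite ltr0n.
have D0 : 0 <= D := le_trans (enorm_ge0 y) (C_bounded Cy).
have DT0 : 0 <= D / T%:R by rewrite divr_ge0// ltW.
have Dc0 t : 0 <= 2 * D / T%:R * c t.
  by rewrite mulr_ge0 ?(ltW (c0 t))// -mulrA mulr_ge0.
have b_ge0 t w : 0 <= b t w.
  have ct0 := ltW (c0 t).
  by rewrite mulr_ge0// addr_ge0// divr_ge0// sqr_ge0.
have path w : K <= F (x T w) + \sum_(t < T) b t w.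
  apply: le_trans (scg_pathwise_bound w) _; rewrite lerD2l.
  apply: ler_sum => t _; rewrite -/(err t w).
  have -> : 2 * D / T%:R * err t w = D / T%:R * (2 * err t w) by ring.
  rewrite ler_wpM2l//.
  have : 0 <= c t * (err t w / c t - 1) ^+ 2.
    by rewrite mulr_ge0 ?sqr_ge0// ltW.
  have -> : c t * (err t w / c t - 1) ^+ 2 =
    err t w ^+ 2 / c t + c t - 2 * err t w by field; rewrite gt_eqF.
  by rewrite subr_ge0.
have mb t : (t < T)%N -> measurable_fun setT (b t).
  move=> tT; apply: measurable_funM => //; apply: measurable_funD => //.
  by apply: measurable_funM => //; exact: scg_error_measurable.
have Eb t : (t < T)%N ->
    (\int[Pr]_w (b t w)%:E <= (2 * D / T%:R * c t)%:E)%E.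
  move=> tT.
  have bE w : (b t w)%:E =
      ((D / T%:R / c t)%:E * (err t w ^+ 2)%:E + (D / T%:R * c t)%:E)%E.
    by rewrite -EFinM -EFinD /b; congr (_%:E); ring.
  under eq_integral do rewrite bE.
  have k0 : 0 <= D / T%:R / c t by rewrite divr_ge0// ltW.
  have err0 w : (0 <= (err t w ^+ 2)%:E)%E by rewrite lee_fin sqr_ge0.
  have merr := proj2 (measurable_EFinP _ _) (scg_error_measurable tT).
  rewrite ge0_integralD//; last 3 first.
  - by move=> w _; rewrite mule_ge0// lee_fin.
  - exact: measurable_funeM.
  - by move=> w _; rewrite lee_fin mulr_ge0// ltW.
  rewrite ge0_integralZl_EFin// integral_cst_probability.
  apply: le_trans (leeD2r _ (lee_wpmul2l _ (rate t tT))) _.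
    by rewrite lee_fin.
  rewrite -EFinM -EFinD lee_fin le_eqVlt; apply/orP; left; apply/eqP.
  by field; rewrite !gt_eqF.
have mF := scg_value_measurable (leqnn T).
have FT0 w : 0 <= F (x T w) by rewrite F_ge0//; exact: scg_iterate_box.
(* Integrals are compared between nonnegative functions only. *)
have [K0|K0] := leP K 0.
  apply: (@le_trans _ _ 0%E); last by apply: integral_ge0 => w _; rewrite lee_fin.
  by rewrite lee_fin subr_le0 (le_trans K0)// sumr_ge0.
rewrite EFinB leeBlDr//.
apply: (@le_trans _ _ (\int[Pr]_w (F (x T w) + \sum_(t < T) b t w)%:E)%E).
  rewrite -(integral_cst_probability Pr K); apply: ge0_le_integral => //.
  - by move=> w _; rewrite lee_fin ltW.
  - apply/measurable_EFinP; apply: measurable_funD => //.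
    by apply: measurable_sum => t; exact: mb.
  - by move=> w _; rewrite lee_fin.
under eq_integral do rewrite EFinD -sumEFin.
rewrite ge0_integralD//; last 4 first.
- by move=> w _; rewrite lee_fin.
- exact/measurable_EFinP.
- by move=> w _; apply: sume_ge0 => t _; rewrite lee_fin.
- by apply: emeasurable_sum => t; apply/measurable_EFinP; exact: mb.
rewrite leeD2l// ge0_integral_sum//; last 2 first.
- by move=> t; apply/measurable_EFinP; exact: mb.
- by move=> t w _; rewrite lee_fin.
by rewrite -sumEFin; apply: lee_sum => t _; exact: Eb.
Qed.

End Run.

(** * Approximation guarantee *)

(** Settles the cases in which the error term of the guarantee is at least the
largest possible increase of F over F 0. *)
Lemma gradient_value_bound (R : realType) (n : nat) (a : 'rV[R]_n)
    (F : 'rV[R]_n -> R) (gF : 'rV[R]_n -> 'rV[R]_n) (L D : R) (y : 'rV[R]_n) :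
  gradient_on (box a) F gF -> 0 <= L ->
  (forall y y', box a y -> box a y' ->
    enorm (gF y - gF y') <= L * enorm (y - y')) ->
  box a 0 -> box a y -> enorm y <= D ->
  F y <= F 0 + D * (enorm (gF 0) + L * D).
Proof.
move=> Fd L0 gL b0 by_ yD.
have [s /andP[s0 s1]] := gradient_on_MVT Fd (fun s hs => box_segment b0 by_ hs).
rewrite subr0 add0r => e.
have bs : box a (s *: y).
  by have := box_segment b0 by_ (_ : 0 <= s <= 1); rewrite subr0 add0r; apply;
    rewrite !ltW.
have ny := enorm_ge0 y; have D0 := le_trans ny yD.
have lip : enorm (gF (s *: y) - gF 0) <= L * D.
  apply: le_trans (gL _ _ bs b0) _; rewrite ler_wpM2l// subr0 enormZ gtr0_norm//.
  by apply: le_trans yD; rewrite ler_piMl// ltW.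
have h1 := Cauchy_Schwarz (gF 0) y.
have h2 := Cauchy_Schwarz (gF (s *: y) - gF 0) y.
have h3 : enorm (gF 0) * enorm y <= enorm (gF 0) * D.
  by rewrite ler_wpM2l// enorm_ge0.
have h4 : enorm (gF (s *: y) - gF 0) * enorm y <= L * D * D.
  by apply: ler_pM => //; exact: enorm_ge0.
by move: e h2; rewrite dotvBl; lra.
Qed.

Theorem theorem7 (R : realType) (n : nat)
    (d d' : measure_display)
    (Omega : measurableType d) (Pr : probability Omega R)
    (Z : measurableType d') (P : probability Z R)
    (a : 'rV[R]_n) (C : set 'rV[R]_n)
    (Ft : 'rV[R]_n -> Z -> R) (gFt : 'rV[R]_n -> Z -> 'rV[R]_n)
    (F : 'rV[R]_n -> R) (gF : 'rV[R]_n -> 'rV[R]_n)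
    (gamma D L sigma OPT : R) (T : nat)
    (z : nat -> {RV Pr >-> Z}) (x dd v : nat -> Omega -> 'rV[R]_n)
    (a_gt0 : forall i, 0 < a 0 i)
    (C_neq0 : C !=set0) (C_sub : C `<=` box a) (C_compact : compact C)
    (C_convex : convex_set (C : set (convex_lmodType 'rV[R]_n)))
    (Ft_integrable : forall y, box a y ->
      P.-integrable setT (EFin \o Ft y))
    (F_def : forall y, box a y -> ((F y)%:E = 'E_P[Ft y])%E)
    (F_diff : gradient_on (box a) F gF)
    (Ft_diff : forall zeta, gradient_on (box a) (Ft ^~ zeta) (gFt ^~ zeta))
    (C_bounded : forall y, C y -> enorm y <= D)
    (F_ge0 : forall y, box a y -> 0 <= F y)
    (F_monotone : monotone_on (box a) F)
    (F_DR : weakly_DR_submodular (box a) gF gamma)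
    (gF_Lipschitz : forall y y', box a y -> box a y' ->
      enorm (gF y - gF y') <= L * enorm (y - y'))
    (gFt_integrable : forall y i, box a y ->
      P.-integrable setT (EFin \o (fun zeta => gFt y zeta 0 i)))
    (gFt_unbiased : forall y i, box a y ->
      ('E_P[(fun zeta => gFt y zeta 0 i)%R] = (gF y 0 i)%R%:E)%E)
    (gFt_variance : forall y, box a y ->
      ('E_P[(fun zeta => enorm (gFt y zeta - gF y) ^+ 2)%R]
         <= (sigma ^+ 2)%R%:E)%E)
    (z_iid : iid_samples P z)
    (T_ge1 : (1 <= T)%N)
    (run : scg_run C gFt (fun t => 4 / ((t%:R + 8) `^ (2 / 3))) T
             (fun t => z t : Omega -> Z) x dd v)
    (OPT_max : is_maximum (F @` C) OPT) :
  let x0 : 'rV[R]_n := 0 in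
  let d0 : 'rV[R]_n := 0 in
  let Q := Num.max (4 * enorm (gF x0 - d0) ^+ 2)
                   (16 * sigma ^+ 2 + 2 * L ^+ 2 * D ^+ 2) in
  (((1 - expR (- gamma)) * OPT - 15 * D * Q `^ (1 / 2) / T%:R `^ (1 / 3)
     - L * D ^+ 2 / (2 * T%:R))%R%:E <= 'E_Pr[fun w => F (x T w)])%E.
Proof.
cbv zeta; rewrite subr0; set Q := Num.max _ _.
have [[y Cy FyOPT] _] := OPT_max.
have by_ := C_sub _ Cy.
have D0 : 0 <= D := le_trans (enorm_ge0 y) (C_bounded _ Cy).
have b0 : box a 0 by split=> i; rewrite mxE// ltW.
have OPT0 : 0 <= OPT by rewrite -FyOPT F_ge0.
have gF0 u i : box a u -> 0 <= gF u 0 i.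
  by move=> bu; exact: (monotone_gradient_ge0 a_gt0 i F_diff F_monotone bu).
have [gamma0 gamma1 gFDR] := weakly_DR_bounds (fun u i => @gF0 u i) F_DR.
have e0 : 0 < expR (- gamma) by exact: expR_gt0.
have shrink : (1 - expR (- gamma)) * OPT <= OPT.
  by rewrite mulrBl mul1r gerBl mulr_ge0// ltW.
pose cT : R := T%:R `^ (1 / 3).
have cT1 : 1 <= cT by apply: powR_third_ge1; rewrite ler1n.
have cT3 : cT ^+ 3 = T%:R by rewrite powR_third_cube.
have cT0 : 0 < cT by rewrite (lt_le_trans _ cT1).
have T0 : 0 < T%:R :> R by rewrite ltr0n.
have Q0 : 0 <= Q by rewrite le_max mulr_ge0 ?sqr_ge0.
pose sQ := Q `^ (1 / 2).
have sQ0 : 0 <= sQ by exact: powR_ge0.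
have sQ2 : sQ ^+ 2 = Q by rewrite /sQ div1r powR12_sqrt// sqr_sqrtr.
have QLD : 16 * sigma ^+ 2 + 2 * L ^+ 2 * D ^+ 2 <= Q by rewrite le_max lexx orbT.
have QgF : 4 * enorm (gF 0) ^+ 2 <= Q by rewrite le_max lexx.
have sQLD : `|L| * D <= sQ.
  rewrite -(ger0_norm D0) -normrM -(ger0_norm sQ0) -ler_sqr ?nnegrE// ?normr_ge0//.
  rewrite !real_normK ?num_real// sQ2 exprMn.
  have := sqr_ge0 sigma; have := mulr_ge0 (sqr_ge0 L) (sqr_ge0 D); lra.
have sQgF : 2 * enorm (gF 0) <= sQ.
  rewrite -ler_sqr ?nnegrE ?mulr_ge0 ?enorm_ge0// sQ2 exprMn.
  by rewrite (_ : 2 ^+ 2 = 4)//; ring.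
have mF := scg_value_measurable a_gt0 C_sub F_diff T_ge1 run (leqnn T).
have bT w : box a (x T w) by exact: (scg_iterate_box a_gt0 C_sub T_ge1 run).
have EF0 : ((F 0)%:E <= \int[Pr]_w (F (x T w))%:E)%E.
  rewrite -(integral_cst_probability Pr (F 0)); apply: ge0_le_integral => //.
  - by move=> w _; rewrite lee_fin F_ge0.
  - exact/measurable_EFinP.
  - move=> w _; rewrite lee_fin F_monotone// => i; rewrite mxE.
    by have [/(_ i)] := bT w; rewrite mxE.
rewrite unlock -/sQ -/cT.
suff main : ((1 - expR (- gamma)) * OPT - 15 * D * sQ / cT -
    L * D ^+ 2 / (2 * T%:R) <= F 0) \/
  (((1 - expR (- gamma)) * OPT - 15 * D * sQ / cT -
    L * D ^+ 2 / (2 * T%:R))%:E <= \int[Pr]_w (F (x T w))%:E)%E.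
  by case: main => // main; apply: le_trans EF0; rewrite lee_fin.
have DsQ : 0 <= D * sQ by exact: mulr_ge0.
(* A negative Lipschitz constant forces the box, hence C, to be the point 0; then
   OPT = F 0, but the term in L has the wrong sign and is absorbed by the other. *)
have [L0|L0] := ltP L 0.
  left; have y0 : y = 0.
    apply: enorm_eq0; apply/eqP; rewrite eq_le enorm_ge0 andbT.
    have := le_trans (enorm_ge0 _) (gF_Lipschitz _ _ by_ b0).
    by rewrite subr0 nmulr_rge0.
  rewrite -FyOPT y0 in shrink OPT0 *.
  have TcT : cT <= T%:R by rewrite -cT3; nra.
  have : - (L * D ^+ 2 / (2 * T%:R)) <= 15 * D * sQ / cT.
    rewrite ltr0_norm// in sQLD.
    rewrite -mulNr ler_pdivrMr ?mulr_gt0// mulrAC ler_pdivlMr//.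
    have h1 : - (L * D ^+ 2) <= D * sQ by have := ler_wpM2l D0 sQLD; lra.
    have h2 : - (L * D ^+ 2) * cT <= D * sQ * T%:R.
      by apply: ler_pM => //; [|exact: ltW];
        rewrite -mulNr mulr_ge0 ?sqr_ge0//; lra.
    have := mulr_ge0 DsQ (ltW T0); lra.
  lra.
rewrite (ger0_norm L0) in sQLD.
have LD0 : 0 <= L * D ^+ 2 / (2 * T%:R).
  by rewrite divr_ge0 ?mulr_ge0 ?sqr_ge0 ?(ltW T0).
have [small|] := boolP ((T <= 7)%N || (Q == 0)).
  left.
  have := gradient_value_bound F_diff L0 gF_Lipschitz b0 by_ (C_bounded _ Cy).
  rewrite FyOPT => bound.
  have bound2 : D * (enorm (gF 0) + L * D) <= D * sQ * (3 / 2).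
    by rewrite -mulrA ler_wpM2l//; lra.
  have : D * sQ * (3 / 2) <= 15 * D * sQ / cT.
    have [/eqP Qz|Qnz] := boolP (Q == 0).
      have -> : sQ = 0 by apply/eqP; rewrite -sqrf_eq0 sQ2 Qz.
      by rewrite !mulr0 !mul0r.
    have T7 : (T <= 7)%N by move: small; rewrite (negbTE Qnz) orbF.
    have cT2 : cT <= 2.
      rewrite -(ler_pXn2r (n := 3))// ?nnegrE ?(ltW cT0)// cT3.
      have : T%:R <= 7 :> R by rewrite ler_nat.
      lra.
    rewrite ler_pdivlMr//; nra.
  lra.
(* From here t < T implies t + 8 <= 2 T, and Q > 0 makes the c_t positive. *)
rewrite negb_or -ltnNge => /andP[T7 Qnz]; right.
have sQ_gt0 : 0 < sQ.
  by rewrite lt0r sQ0 andbT -sqrf_eq0 sQ2.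
pose r t : R := (t%:R + 8) `^ (1 / 3).
have r0 t : 0 < r t by rewrite powR_gt0// ltr_wpDl.
pose c t := sQ / r t.
have c0 t : 0 < c t by exact: divr_gt0.
have mFt u : box a u -> measurable_fun setT (Ft u).
  by move=> bu; have /integrableP[/measurable_EFinP] := Ft_integrable u bu.
have rate t : (t < T)%N ->
    (\int[Pr]_w (enorm (scg_error gF x dd t w) ^+ 2)%:E <= (c t ^+ 2)%:E)%E.
  have -> : c t ^+ 2 = Q / r t ^+ 2 by rewrite /c expr_div_n sQ2.
  apply: (@error_rate R
    (fun t => \int[Pr]_w (enorm (scg_error gF x dd t w) ^+ 2)%:E)%E
    (fun t => 4 / ((t%:R + 8) `^ (2 / 3))) Q L D sigma T (ltnW T7)) => //.
    have [x00 _ _ _ _] := run.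
    under eq_integral => w _ do rewrite /scg_error (x00 w).1 (x00 w).2 subr0.
    by rewrite integral_cst_probability lee_fin ler_pdivlMr// mulrC.
  move=> s sT s0 s1 {t}.
  exact: (scg_error_step a_gt0 C_sub C_bounded F_diff gF_Lipschitz L0 T_ge1 run
    mFt Ft_diff gFt_integrable gFt_unbiased gFt_variance z_iid sT s0 s1).
have sum_c : \sum_(t < T) 2 * D / T%:R * c t <= 15 * D * sQ / cT.
  rewrite -mulr_sumr.
  have -> : \sum_(t < T) c t = sQ * \sum_(t < T) (r t)^-1 by rewrite mulr_sumr.
  apply: (@le_trans _ _ (2 * D / T%:R * (sQ * (2 * cT ^+ 2)))).
    rewrite ler_wpM2l ?mulr_ge0 ?invr_ge0 ?(ltW T0)//.
    by rewrite ler_wpM2l// sum_inv_cube_root.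
  have -> : 2 * D / T%:R * (sQ * (2 * cT ^+ 2)) = 4 * (D * sQ / cT).
    by rewrite -cT3; field; rewrite gt_eqF.
  have : 0 <= D * sQ / cT by rewrite divr_ge0// ltW.
  by rewrite -!mulrA; lra.
have := scg_expected_value a_gt0 C_sub C_bounded F_diff gF_Lipschitz L0 T_ge1
  run mFt Ft_diff gamma0 gamma1 gF0 gFDR F_monotone F_ge0 Cy c0 rate.
by rewrite FyOPT; apply: le_trans; rewrite lee_fin; lra.
Qed.
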